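(* Let $p\ge 2$, $\alpha=p-1$, $\theta\ge 0$ and $0\le\mu<\mu_{\alpha,\theta}$. Then the supremum $TMSC(\mu,\alpha,\theta)$ is attained, i.e. there exists $u\in X^{1,p}_\infty(\alpha,\theta)\setminus\{0\}$ with $\|u'\|_{L^p_\alpha}\le 1$ and $$TMSC(\mu,\alpha,\theta)=\frac{1}{\|u\|^p_{L^p_\theta}}\int_0^\infty\varphi_p\left(\mu|u|^{\frac{p}{p-1}}\right)\mathrm{d}\lambda_\theta .$$
   Context: For real $\theta\ge 0$ let $\omega_\theta=\frac{2\pi^{(\theta+1)/2}}{\Gamma((\theta+1)/2)}$ and $\int_0^\infty f(r)\,\mathrm{d}\lambda_\theta=\omega_\theta\int_0^\infty f(r)r^\theta\,\mathrm{d}r$. For $1\le q<\infty$, $L^q_\theta$ is the space of measurable $u$ on $(0,\infty)$ with $\|u\|_{L^q_\theta}=\left(\int_0^\infty |u|^q\,\mathrm{d}\lambda_\theta\right)^{1/q}<\infty$ (similarly with $\alpha$ in place of $\theta$). $X^{1,p}_\infty=X^{1,p}_\infty(\alpha,\theta)$ is the set of all locally absolutely continuous functions $u$ on $(0,\infty)$ with $\lim_{r\to\infty}u(r)=0$, $u\in L^p_\theta$ and $u'\in L^p_\alpha$. $\mu_{\alpha,\theta}=(\theta+1)\omega_\alpha^{1/\alpha}$. For $t\ge 0$, $\varphi_p(t)=\sum_{j\in\mathbb{N},\, j\ge p-1}\frac{t^j}{j!}$. For $0\le\mu<\mu_{\alpha,\theta}$, $$TMSC(\mu,\alpha,\theta)=\sup\left\{\frac{1}{\|u\|^p_{L^p_\theta}}\int_0^\infty\varphi_p\left(\mu|u|^{\frac{p}{p-1}}\right)\mathrm{d}\lambda_\theta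 \;:\; u\in X^{1,p}_\infty(\alpha,\theta)\setminus\{0\},\ \|u'\|_{L^p_\alpha}\le 1\right\}.$$ *)

(* Defs.v *)
From HB Require Import structures.
From mathcomp Require Import all_boot all_order all_algebra.
From mathcomp Require Import all_classical all_reals all_analysis.

Set Implicit Arguments.
Unset Strict Implicit.
Unset Printing Implicit Defensive.

Import Order.TTheory GRing.Theory Num.Theory.
Import numFieldNormedType.Exports.

Local Open Scope classical_set_scope.
Local Open Scope ring_scope.

Definition Gamma (R : realType) (x : R) : R :=
  (\int[lebesgue_measure]_(t in `]0, +oo[) (t `^ (x - 1) * expR (- t)))%R.

Definition omega (R : realType) (theta : R) : R :=
  2 * pi `^ ((theta + 1) / 2) / Gamma ((theta + 1) / 2).

Definition mu_crit (R : realType) (alpha theta : R) : R :=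
  (theta + 1) * omega alpha `^ alpha^-1.

(* The integral over (0, oo) of f against lambda_theta.  It is extended-real
   valued because the integrals entering the supremum are not known a priori
   to be finite. *)
Definition wint (R : realType) (theta : R) (f : R -> R) : \bar R :=
  ((omega theta)%:E *
   \int[lebesgue_measure]_(r in `]0%R, +oo[) (f r * r `^ theta)%:E)%E.

Definition wnorm (R : realType) (q theta : R) (u : R -> R) : \bar R :=
  (wint theta (fun r => `|u r| `^ q)%R `^ (q^-1)%R)%E.

(* A function on (0, oo) is represented by a function on R; its values on
   (-oo, 0] are irrelevant. *)
Definition wLspace (R : realType) (q theta : R) : set (R -> R) :=
  [set u : R -> R | measurable_fun (`]0, +oo[ : set R) u /\ (wnorm q theta u < +oo)%E].

Definition abs_continuous (R : realType) (a b : R) (u : R -> R) : Prop :=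
  forall e : R, 0 < e -> exists2 d : R, 0 < d &
    forall (n : nat) (x y : 'I_n -> R),
      (forall i, [/\ a <= x i, x i <= y i & y i <= b]) ->
      trivIset setT (fun i => `]x i, y i[%classic) ->
      \sum_(i < n) (y i - x i) < d ->
      \sum_(i < n) `|u (y i) - u (x i)| < e.

Definition loc_abs_continuous (R : realType) (u : R -> R) : Prop :=
  forall a b : R, 0 < a -> a < b -> abs_continuous a b u.

(* [derive1 u] is a total function, equal to the classical derivative wherever it
   exists, hence almost everywhere on (0, oo) when u is locally absolutely
   continuous there. *)
Definition Xspace (R : realType) (p alpha theta : R) : set (R -> R) :=
  [set u : R -> R | [/\ loc_abs_continuous u,
               u r @[r --> +oo] --> (0 : R),
               wLspace p theta u &
               wLspace p alpha (derive1 u)]].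

Definition phi (R : realType) (p t : R) : R :=
  limn (fun n => \sum_(0 <= j < n | p - 1 <= j%:R) t ^+ j / (j`!)%:R).

Definition TM_quotient (R : realType) (p theta mu : R) (u : R -> R) : \bar R :=
  ((wnorm p theta u `^ p)^-1 *
   wint theta (fun r => phi p (mu * `|u r| `^ (p / (p - 1))))%R)%E.

(* u is not the zero element of the space of functions on (0, oo). *)
Definition nonzero (R : realType) (u : R -> R) : Prop :=
  exists2 r : R, 0 < r & u r != 0.

Definition admissible (R : realType) (p alpha theta : R) : set (R -> R) :=
  [set u : R -> R | [/\ Xspace p alpha theta u, nonzero u &
               (wnorm p alpha (derive1 u) <= 1)%E]].

Definition TMSC (R : realType) (p mu alpha theta : R) : \bar R :=
  ereal_sup [set TM_quotient p theta mu u | u in admissible p alpha theta].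

(* Main.v *)
(* Since alpha = p - 1, the norm of u' in L^p_alpha and the quotient are invariant
   under dilations, so one may normalize the norm of u in L^p_theta.  Writing
   phi_p t = c t^(p - 1) + psi t, where every term of psi has degree > p - 1, the
   quotient becomes the constant c mu^(p - 1) plus the integral of
   psi (mu |u|^(p / (p - 1))), over the norm of u to the power p.  Hoelder's
   inequality for u' against dr / r gives
   |u r - u s| <= omega_alpha^(-1/p) |ln r - ln s|^((p - 1) / p), hence
   equicontinuity, the majorant (M / r)^gamma with gamma < theta + 1 near 0
   precisely because mu < mu_crit, and uniform decay at infinity.  So a maximizing
   sequence has a pointwise limit v, the integrals of psi converge, and by Fatou
   the norms do not increase; if v = 0 then the integral of psi vanishes on all
   admissible functions and any of them is a maximizer.

   The derivative is handled through Riesz' condition log_energy_le.  That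
   admissible functions satisfy it needs the fundamental theorem of calculus for
   absolutely continuous functions: the variation function and its difference
   with u are monotone, and their Stieltjes measures have Radon-Nikodym
   densities.  That limits satisfying it are admissible is Fatou's lemma. *)

Require Import Defs.
From HB Require Import structures.
From mathcomp Require Import all_boot all_order all_algebra.
From mathcomp Require Import all_classical all_reals all_analysis.
From mathcomp Require Import measurable_realfun ring lra.

Set Implicit Arguments.
Unset Strict Implicit.
Unset Printing Implicit Defensive.

Import Order.TTheory GRing.Theory Num.Theory.
Import numFieldNormedType.Exports.

Local Open Scope classical_set_scope.
Local Open Scope ring_scope.

(** * Absolutely continuous functions *)

(** For integer p the term of degree p - 1 has to be split off: at mu |u|^(p / (p - 1)) it is a
    multiple of |u|^p, whose integral is not continuous under pointwise convergence, since mass may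
    escape to infinity. Where |u| <= e the remaining terms are at most a constant times a positive
    power of e times |u|^p, so they lose nothing at infinity.

    The maximization takes place over a ball, with norm at most 1, and not over a sphere, because
    the ball is closed under pointwise limits. A loss of norm is harmless: at a given integral of
    psi, a smaller norm can only raise the quotient.

    The number [mu_crit] comes from Hoelder's bound: raised to the power p / (p - 1) it is linear in
    ln (M / r), so the exponential of mu |u|^(p / (p - 1)) is bounded by a power of M / r with
    exponent near mu omega_alpha^(-1 / alpha). The value of u at M has to be separated from the
    increment between r and M, which costs a factor (1 + eta)^(p / (p - 1)) in that exponent; the
    strict inequality mu < mu_crit pays for it. *)

Definition clamp (R : realType) (a b x : R) : R := Num.max a (Num.min x b).

Lemma clamp_in (R : realType) (a b x : R) : a <= b -> a <= clamp a b x <= b.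
Proof.
by move=> ab; rewrite /clamp le_max lexx /= ge_max ab /= ge_min lexx orbT.
Qed.

Lemma clamp_id (R : realType) (a b x : R) : a <= x <= b -> clamp a b x = x.
Proof. by move=> /andP[ax xb]; rewrite /clamp min_l// max_r. Qed.

Lemma le_clamp (R : realType) (a b x y : R) : x <= y -> clamp a b x <= clamp a b y.
Proof. by move=> xy; rewrite /clamp le_max2 // le_min2. Qed.

Lemma clampB_le (R : realType) (a b x y : R) : x <= y ->
  clamp a b y - clamp a b x <= y - x.
Proof. by rewrite /clamp /Num.max /Num.min; do ! case: ifPn; lra. Qed.

Lemma clamp_itv (R : realType) (a b x y z : R) : a <= b ->
  clamp a b x < z < clamp a b y -> x < z < y.
Proof. by rewrite /clamp /Num.max /Num.min; do ! case: ifPn; lra. Qed.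

(* Arbitrary finite index types, because refining each interval of a family
   produces a family indexed by a dependent sum. *)
Definition abs_continuousT (R : realType) (w : R -> R) : Prop :=
  forall e : R, 0 < e -> exists2 d : R, 0 < d &
    forall (T : finType) (x y : T -> R),
      (forall i, x i <= y i) ->
      trivIset setT (fun i => `]x i, y i[%classic) ->
      \sum_i (y i - x i) < d ->
      \sum_i `|w (y i) - w (x i)| < e.

Lemma trivIset_oo (R : realType) (T : eqType) (x y : T -> R) :
  trivIset setT (fun i => `]x i, y i[%classic) <->
  forall i j z, x i < z < y i -> x j < z < y j -> i = j.
Proof.
split.
  move=> tI i j z zi zj; apply: (tI i j I I); exists z.
  by split; rewrite /= in_itv.
move=> H; apply/trivIsetP => i j _ _ ij; apply/seteqP; split => // z [] /=.
by rewrite !in_itv /= => zi zj; move/eqP: ij; apply; exact: H zi zj.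
Qed.

(** Clamping is monotone and 1-Lipschitz, so it maps a disjoint family of intervals to a disjoint
    family of no greater total length. The composite lives on the whole line, where Stieltjes
    measures and continuity involve no endpoints. *)
Lemma abs_continuous_clamp (R : realType) (a b : R) (u : R -> R) : a <= b ->
  abs_continuous a b u -> abs_continuousT (u \o clamp a b).
Proof.
move=> ab uac e /uac[d d0 H]; exists d => // T x y xy /trivIset_oo tI sd.
have E (F : T -> R) : \sum_i F i = \sum_(j < #|T|) F (enum_val j).
  by rewrite -big_enum_val.
rewrite E; apply: H.
- move=> j; have /andP[? ?] := clamp_in (x (enum_val j)) ab.
  by have /andP[? ?] := clamp_in (y (enum_val j)) ab; rewrite le_clamp.
- apply/trivIset_oo => i j z /(clamp_itv ab) zi /(clamp_itv ab) zj.
  by apply/enum_val_inj/(tI _ _ z).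
- rewrite -(E (fun i => clamp a b (y i) - clamp a b (x i))).
  apply: le_lt_trans sd; by apply: ler_sum => i _; exact: clampB_le.
Qed.

Lemma itv_partition_lt_nth (R : realType) (a b : R) (s : seq R) (i j : nat) :
  itv_partition a b s -> (i < j)%N -> (j <= size s)%N ->
  nth b (a :: s) i < nth b (a :: s) j.
Proof.
move=> [ps _] ij js.
by rewrite (@lt_sorted_ltn_nth _ _ b (a :: s)) // inE /= ltnS // (leq_trans (ltnW ij)).
Qed.

Lemma itv_partition_nth_in (R : realType) (a b : R) (s : seq R) (i : nat) :
  itv_partition a b s -> (i <= size s)%N -> a <= nth b (a :: s) i <= b.
Proof.
move=> abs js; apply/andP; split.
  case: i js => [//|i] js; exact/ltW/(@itv_partition_lt_nth _ a b s 0 i.+1).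
have sb : nth b (a :: s) (size s) = b by case: abs => _ /eqP <-; rewrite nth_last.
rewrite -[leRHS]sb; move: js; rewrite leq_eqVlt => /predU1P[->//|js].
exact/ltW/(@itv_partition_lt_nth _ a b s i).
Qed.

(** Cutting every interval at the points of its partition yields one larger disjoint family of the
    same total length, to which the hypothesis applies as it stands. A bound on increments thus
    becomes a bound on variations. *)
Lemma sum_variation_lt (R : realType) (w : R -> R) (e d : R) :
  (forall (T : finType) (x y : T -> R), (forall i, x i <= y i) ->
      trivIset setT (fun i => `]x i, y i[%classic) ->
      \sum_i (y i - x i) < d -> \sum_i `|w (y i) - w (x i)| < e) ->
  forall (T : finType) (x y : T -> R) (s : T -> seq R), (forall i, x i <= y i) ->
      trivIset setT (fun i => `]x i, y i[%classic) ->
      \sum_i (y i - x i) < d ->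
  (forall i, itv_partition (x i) (y i) (s i)) ->
  \sum_i variation (x i) (y i) w (s i) < e.
Proof.
move=> H T x y s xy /trivIset_oo tI sd sP.
pose N i j := nth (y i) (x i :: s i) j.
pose J := {i : T & 'I_(size (s i))}.
pose X (p : J) := N (tag p) (tagged p).
pose Y (p : J) := N (tag p) (tagged p).+1.
have -> : \sum_i variation (x i) (y i) w (s i) = \sum_(p : J) `|w (Y p) - w (X p)|.
  rewrite /variation.
  under eq_bigr => i _ do rewrite big_mkord.
  by rewrite (sig_big_dep xpredT (fun _ => xpredT)
    (fun i (j : 'I_(size (s i))) => `|w (N i j.+1) - w (N i j)|)).
apply: H.
- move=> [i j]; rewrite /X /Y /=.
  by apply/ltW/itv_partition_lt_nth => //; exact: sP.
- apply/trivIset_oo => -[i j] [i' j'] z; rewrite /X /Y /=.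
  move=> /andP[h1 h2] /andP[h3 h4].
  have ii : i = i'.
    apply: (tI _ _ z).
      have /andP[? _] := itv_partition_nth_in (sP i) (ltnW (ltn_ord j)).
      have /andP[_ ?] := itv_partition_nth_in (sP i) (ltn_ord j).
      by apply/andP; split; [exact: le_lt_trans h1|exact: lt_le_trans h2 _].
    have /andP[? _] := itv_partition_nth_in (sP i') (ltnW (ltn_ord j')).
    have /andP[_ ?] := itv_partition_nth_in (sP i') (ltn_ord j').
    by apply/andP; split; [exact: le_lt_trans h3|exact: lt_le_trans h4 _].
  subst i'.
  suff -> : j = j' by [].
  have key (k l : 'I_(size (s i))) : (k < l)%N -> N i k.+1 <= N i l.
    rewrite leq_eqVlt => /predU1P[->//|kl]; apply/ltW.
    by apply: itv_partition_lt_nth => //; exact: ltnW.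
  case: (ltngtP j j') => jj; last exact: val_inj.
    by have := lt_trans (lt_le_trans h2 (key _ _ jj)) h3; rewrite ltxx.
  by have := lt_trans (lt_le_trans h4 (key _ _ jj)) h1; rewrite ltxx.
- apply: le_lt_trans sd; rewrite le_eqVlt; apply/orP; left; apply/eqP.
  rewrite -(sig_big_dep xpredT (fun _ => xpredT)
    (fun i (j : 'I_(size (s i))) => (N i j.+1) - (N i j))) /=.
  apply: eq_bigr => i _; rewrite -(big_mkord xpredT (fun j => N i j.+1 - N i j)).
  rewrite telescope_sumr // /N /=; congr (_ - _).
  by case: (sP i) => _ /eqP e0; rewrite -[RHS]e0 (last_nth (y i)).
Qed.

Lemma total_variation_fin_num (R : realType) (w : R -> R) (a b M : R) : a <= b ->
  (forall s, itv_partition a b s -> variation a b w s <= M) ->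
  (total_variation a b w \is a fin_num) && (total_variation a b w <= M%:E)%E.
Proof.
move=> ab H.
have tM : (total_variation a b w <= M%:E)%E.
  by apply: ge_ereal_sup => _ [_ [s sP <-] <-]; rewrite lee_fin H.
by rewrite tM andbT ge0_fin_numE ?(le_lt_trans tM) ?ltry //; exact: total_variation_ge0.
Qed.

Lemma sum_total_variation_le (R : realType) (w : R -> R) : abs_continuousT w ->
  forall e : R, 0 < e -> exists2 d : R, 0 < d &
    forall (T : finType) (x y : T -> R),
      (forall i, x i <= y i) ->
      trivIset setT (fun i => `]x i, y i[%classic) ->
      \sum_i (y i - x i) < d ->
      (forall i, total_variation (x i) (y i) w \is a fin_num) /\
      \sum_i fine (total_variation (x i) (y i) w) <= e.
Proof.
move=> wac e /wac[d d0 H]; exists d => // T x y xy tI sd.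
have fin i : total_variation (x i) (y i) w \is a fin_num.
  suff /(total_variation_fin_num (xy i))/andP[] : forall s,
      itv_partition (x i) (y i) s -> variation (x i) (y i) w s <= e by [].
  move=> s si; have := @sum_variation_lt R w e d H unit (fun=> x i) (fun=> y i) (fun=> s).
  have S (r : R) : \sum_(j : unit) r = r.
    by rewrite big_const card_unit /= addr0.
  rewrite !S => /(_ (fun=> xy i)) K; apply/ltW; apply: K => //.
    by apply/trivIsetP => -[] [].
  apply: le_lt_trans sd; rewrite (bigD1 i) //= lerDl sumr_ge0 // => j _.
  by rewrite subr_ge0.
split => //.
apply/ler_addgt0Pr => eta eta0.
(* Each supremum is approximated up to [eta / n] by one partition; these #|T| errors add up to at
   most [eta]. The successor keeps [n] positive when [T] is empty. *)
pose n : R := (#|T|.+1)%:R.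
have n0 : 0 < eta / n by rewrite divr_gt0 // ltr0n.
have ch i : exists s, itv_partition (x i) (y i) s /\
    fine (total_variation (x i) (y i) w) <= variation (x i) (y i) w s + eta / n.
  have [_ [_ [s sP <-] <-]] := ub_ereal_sup_adherent n0 (fin i) => lts.
  exists s; split => //.
  rewrite -lee_fin EFinD -leeBlDr // ltW //.
  by rewrite fineK // fin.
have [s sP] := choice ch.
have := @sum_variation_lt R w e d H T x y s xy tI sd (fun i => (sP i).1).
move=> /ltW le_e.
have : \sum_i fine (total_variation (x i) (y i) w) <=
  \sum_i (variation (x i) (y i) w (s i) + eta / n).
  by apply: ler_sum => i _; exact: (sP i).2.
move=> /le_trans; apply; rewrite big_split /= lerD //.
rewrite sumr_const -mulr_natl mulrCA ger_pMr // ler_pdivrMr ?ltr0n // mul1r ler_nat.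
by rewrite leqnSn.
Qed.

(** The variation is finite on intervals shorter than [d], and [a, b] is reached from [a] by
    finitely many steps of length d / 2, over which the total variation is additive. *)
Lemma abs_continuousT_TV_fin_num (R : realType) (w : R -> R) (a b : R) :
  abs_continuousT w -> a <= b -> total_variation a b w \is a fin_num.
Proof.
move=> /sum_total_variation_le/(_ 1 ltr01)[d d0 H].
have short x y : x <= y -> y - x < d -> total_variation x y w \is a fin_num.
  move=> xy yx; have [] := H unit (fun=> x) (fun=> y) (fun=> xy).
  - by apply/trivIsetP => -[] [].
  - by rewrite big_const card_unit /= addr0.
  - by move=> /(_ tt).
have long n c : a <= c -> c <= a + n%:R * (d / 2) -> total_variation a c w \is a fin_num.
  elim: n c => [|n IH] c ac.
    by rewrite mul0r addr0 => ca; rewrite (@le_anti _ _ c a) ?ca // total_variationxx.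
  move=> cn; have [cn'|cn'] := leP c (a + n%:R * (d / 2)); first exact: IH.
  have an : a <= a + n%:R * (d / 2) by rewrite lerDl mulr_ge0 // ltW // divr_gt0.
  rewrite (total_variationD _ an (ltW cn')) fin_numD IH //= short //; first exact: ltW.
  move: cn; rewrite -natr1 => cn; nra.
move=> ab; apply: (long (Num.bound ((b - a) / (d / 2)))) => //.
have : (b - a) / (d / 2) <= (Num.bound ((b - a) / (d / 2)))%:R.
  by apply: ltW; apply: archi_boundP; rewrite divr_ge0 ?subr_ge0 // ltW // divr_gt0.
by rewrite ler_pdivrMr ?divr_gt0 // lerBlDl.
Qed.

Definition variation_fun (R : realType) (a b : R) (u : R -> R) (x : R) : R :=
  fine (total_variation a (clamp a b x) (u \o clamp a b)).

Lemma variation_funB (R : realType) (a b : R) (u : R -> R) (x y : R) :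
  a <= b -> abs_continuous a b u -> x <= y ->
  variation_fun a b u y - variation_fun a b u x =
  fine (total_variation (clamp a b x) (clamp a b y) (u \o clamp a b)).
Proof.
move=> ab /(abs_continuous_clamp ab) wac xy.
have /andP[ax xb] := clamp_in x ab; have /andP[ay yb] := clamp_in y ab.
have cxy := le_clamp a b xy.
rewrite /variation_fun [in X in X - _](total_variationD _ ax cxy).
by rewrite fineD ?abs_continuousT_TV_fin_num // addrAC subrr add0r.
Qed.

Lemma variation_fun_ge (R : realType) (a b : R) (u : R -> R) (x y : R) :
  a <= b -> abs_continuous a b u -> x <= y ->
  `|u (clamp a b y) - u (clamp a b x)| <=
  variation_fun a b u y - variation_fun a b u x.
Proof.
move=> ab uac xy; rewrite variation_funB //.
have cxy := le_clamp a b xy.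
have := total_variation_ge (u \o clamp a b) cxy.
rewrite /= !(clamp_id (clamp_in _ ab)) => h.
rewrite -lee_fin fineK // abs_continuousT_TV_fin_num //.
exact: abs_continuous_clamp.
Qed.

(** The increments of the variation function are total variations, whose sum over a short family is
    at most e / 2; halving restores the strict inequality. *)
Lemma abs_continuousT_variation_fun (R : realType) (a b : R) (u : R -> R) :
  a <= b -> abs_continuous a b u -> abs_continuousT (variation_fun a b u).
Proof.
move=> ab uac e e0; have e20 : 0 < e / 2 by rewrite divr_gt0.
have [d d0 H] := sum_total_variation_le (abs_continuous_clamp ab uac) e20.
exists d => // T x y xy /trivIset_oo tI sd.
have [] := H T (clamp a b \o x) (clamp a b \o y).
- by move=> i; exact: le_clamp.
- by apply/trivIset_oo => i j z /= /(clamp_itv ab) zi /(clamp_itv ab); exact: tI zi.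
- by apply: le_lt_trans sd; apply: ler_sum => i _; exact: clampB_le.
move=> _ sle; apply: (@le_lt_trans _ _ (e / 2)); last by lra.
apply: le_trans sle; apply: ler_sum => i _.
rewrite variation_funB // ger0_norm // fine_ge0 // total_variation_ge0 //.
exact: le_clamp.
Qed.

Lemma abs_continuousT_continuous (R : realType) (w : R -> R) :
  abs_continuousT w -> continuous w.
Proof.
move=> wac x; apply/cvgrPdist_lt => e /wac[d d0 H].
have K y z : y <= z -> z - y < d -> `|w z - w y| < e.
  move=> yz zy; have := H unit (fun=> y) (fun=> z) (fun=> yz).
  rewrite !big_const card_unit /= !addr0; apply => //.
  by apply/trivIsetP => -[] [].
near=> y; have dxy : `|x - y| < d by near: y; exact: cvgr_dist_lt.
have [xy|yx] := leP x y.
  by rewrite distrC K // -(ger0_norm (_ : 0 <= y - x)) ?subr_ge0 // distrC.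
by rewrite K // ?ltW // -(ger0_norm (_ : 0 <= x - y)) // subr_ge0 ltW.
Unshelve. all: by end_near. Qed.

(** * Stieltjes measures and their densities *)

Lemma lebesgue_stieltjes_oc (R : realType) (c : cumulative R R) (x y : R) :
  x <= y -> lebesgue_stieltjes_measure c `]x, y]%classic = (c y - c x)%:E.
Proof.
move=> xy; rewrite /lebesgue_stieltjes_measure /measure_extension measurable_mu_extE //=.
  by rewrite wlength_itv_bnd.
exact: is_ocitv.
Qed.

(** Gives endpoints to the components of an open set, so that they can enter a family of intervals.
    Finite measure excludes the unbounded shapes, and the empty set is represented by a degenerate
    interval. *)
Lemma open_interval_oo (R : realType) (X : set R) : open X -> is_interval X ->
  (lebesgue_measure X < +oo)%E ->
  exists p : R * R, [/\ p.1 <= p.2, X = `]p.1, p.2[%classic &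
    lebesgue_measure X = (p.2 - p.1)%:E].
Proof.
move=> oX /is_intervalP XE.
have oo0 (A : set R) : A = set0 -> (lebesgue_measure A < +oo)%E ->
    exists p : R * R, [/\ p.1 <= p.2, A = `]p.1, p.2[%classic &
    lebesgue_measure A = (p.2 - p.1)%:E].
  by move=> -> _; exists (0, 0); split => //=; rewrite ?set_itvoo0 ?measure0 ?subrr.
move: XE (oX) => ->; case: (Rhull X) => -[b x|b] [b' y|b'] /interior_id XE.
- rewrite -XE interior_itv_bnd => fin.
  have [xy|yx] := leP x y; last first.
    by apply: oo0 fin; apply/seteqP; split => z //=; rewrite in_itv /= => /andP[/lt_trans h /h];
      rewrite ltNge ltW.
  exists (x, y); split => //=; rewrite lebesgue_measure_itv /= lte_fin.
  by case: ltgtP xy => // -> _; rewrite subrr.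
- by case: b' XE => XE; first [by rewrite lebesgue_measure_itv //= ?ltry ?ltNyr |
    by apply: oo0; apply/seteqP; split => z //=; rewrite in_itv //= ?andbF].
- by case: b XE => XE; first [by rewrite lebesgue_measure_itv //= ?ltry ?ltNyr |
    by apply: oo0; apply/seteqP; split => z //=; rewrite in_itv //= ?andbF].
- by case: b b' XE => -[] XE; first [by rewrite lebesgue_measure_itv //= ?ltry ?ltNyr |
    by apply: oo0; apply/seteqP; split => z //=; rewrite in_itv //= ?andbF].
Qed.

(** Absolute continuity of [g] makes its Stieltjes measure absolutely continuous: a null set lies in
    an open set of measure less than [d], and the increments of [g] over the components of that set
    add up to at most [e]. The restriction to ]a, b] makes the measure finite, as the Radon-Nikodym
    theorem requires. *)
Lemma monotone_density (R : realType) (g : R -> R) (a b : R) :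
  {homo g : x y / x <= y} -> abs_continuousT g -> a <= b ->
  exists f : R -> R, [/\ forall x, 0 <= f x,
    lebesgue_measure.-integrable setT (EFin \o f) &
    forall x y, a <= x -> x <= y -> y <= b ->
      (g y - g x)%:E = (\int[lebesgue_measure]_(t in `]x, y]) (f t)%:E)%E].
Proof.
move=> gnd gac ab.
have rc : right_continuous g.
  by apply: right_continuousW => x; exact: abs_continuousT_continuous.
pose c : cumulative R R := HB.pack g (isCumulative.Build R _ R g gnd rc).
pose nu0 := lebesgue_stieltjes_measure c.
have mab : measurable (`]a, b]%classic : set (measurableTypeR R)) by exact: measurable_itv.
have nuoo : (nu0 `]a, b]%classic < +oo)%E.
  by rewrite /nu0 lebesgue_stieltjes_oc // ltry.
pose nu := mfrestr mab nuoo.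
have dom : nu `<< (@lebesgue_measure R).
  apply/null_content_dominatesP => N mN N0.
  rewrite /nu /mfrestr /mrestr /=.
  apply/eqP; rewrite eq_le measure_ge0 andbT; apply/lee_addgt0Pr => e e0.
  rewrite add0e; have [d d0 H] := gac e e0.
  have Nfin : (lebesgue_measure N < +oo)%E by rewrite N0 ltry.
  have [U [oU NU dU]] := lebesgue_regularity_outer mN Nfin d0.
  have mU : measurable U by exact: open_measurable.
  have Ud : (lebesgue_measure U < d%:E)%E.
    rewrite (measureDI (@lebesgue_measure R) mU mN) (setIidr NU) N0 adde0; exact: dU.
  have mI k : measurable (open_disjoint_itv oU k).
    apply: open_measurable; exact: open_disjoint_itv_open.
  have IU k : open_disjoint_itv oU k `<=` U.
    move=> z zk; have : (\bigcup_q open_disjoint_itv oU q) z by exists k.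
    by rewrite -open_disjoint_itv_bigcup.
  have Ifin k : (lebesgue_measure (open_disjoint_itv oU k) < +oo)%E.
    apply: (@le_lt_trans _ _ (lebesgue_measure U)); last exact: lt_trans Ud (ltry d).
    apply: le_measure; rewrite ?inE //; exact: mI.
  have oI k : open (open_disjoint_itv oU k) by exact: open_disjoint_itv_open.
  have iI k : is_interval (open_disjoint_itv oU k).
    exact: open_disjoint_itv_is_interval.
  have [p pP] := choice (fun k => open_interval_oo (oI k) (iI k) (Ifin k)).
  have tI : trivIset setT (open_disjoint_itv oU) by exact: open_disjoint_itv_trivIset.
  have UE := open_disjoint_itv_bigcup oU.
  (* Absolute continuity speaks of finite families, so the components are summed up to [n]; the
     bound does not depend on [n] and survives the limit. *)
  have part n : (\sum_(0 <= k < n) nu0 (open_disjoint_itv oU k) <= e%:E)%E.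
    have /ltW le_e : \sum_(k < n) `|g (p k).2 - g (p k).1| < e.
     apply: H.
    - by move=> k; case: (pP k).
    - apply/trivIset_oo => k l z kz lz; apply/val_inj/(tI k l I I); exists z.
      have [_ -> _] := pP k; have [_ -> _] := pP l.
      by split; rewrite /= in_itv.
    - rewrite -lte_fin; apply: le_lt_trans Ud.
      have -> : (\sum_(k < n) ((p k).2 - (p k).1))%:E =
          (\sum_(0 <= k < n) lebesgue_measure (open_disjoint_itv oU k))%E.
        by rewrite -sumEFin big_mkord; apply: eq_bigr => k _; case: (pP k).
      apply: (@le_trans _ _ (\sum_(0 <= k <oo) lebesgue_measure (open_disjoint_itv oU k))%E).
        by apply: nneseries_lim_ge => k _ _; exact: measure_ge0.
      rewrite -measure_semi_bigcup // -?UE //.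
    rewrite -lee_fin in le_e; apply: le_trans le_e.
    rewrite big_mkord -sumEFin; apply: lee_sum => k _; have [pk -> _] := pP k.
    rewrite (le_trans _ (_ : ((c (p k).2 - c (p k).1)%:E <= _)%E)) ?lee_fin ?ler_norm //.
    rewrite -lebesgue_stieltjes_oc //; apply: le_measure; rewrite ?inE //.
    by move=> z /=; rewrite !in_itv /= => /andP[-> /ltW].
  apply: (@le_trans _ _ (nu0 U)).
    apply: le_measure; rewrite ?inE //; first exact: measurableI.
    by move=> z [/NU].
  have -> : nu0 U = (\sum_(0 <= k <oo) nu0 (open_disjoint_itv oU k))%E.
    rewrite [X in nu0 X]UE; apply: (@measure_semi_bigcup _ _ _ nu0) => //.
    by rewrite -UE.
  apply: lime_le; first by apply: is_cvg_nneseries => k _ _; exact: measure_ge0.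
  by apply: nearW => n; exact: part.
have [f [f0 ffin fint nuE]] :=
  @radon_nikodym_sigma_finite _ _ R lebesgue_measure (mfrestr mab nuoo) dom.
exists (fine \o f); split.
- by move=> x; rewrite fine_ge0 // f0.
- by apply: eq_integrable fint => // x _ /=; rewrite fineK.
- move=> x y ax xy yb; rewrite -(lebesgue_stieltjes_oc c) //.
  have mxy : measurable (`]x, y]%classic : set R) by exact: measurable_itv.
  under eq_integral do rewrite /= fineK //.
  rewrite -nuE // /nu /mfrestr /mrestr; congr (_ _).
  apply/esym/setIidl => z /=; rewrite !in_itv /= => /andP[xz zy].
  by rewrite (le_lt_trans ax) // (le_trans zy).
Qed.

Lemma near_eq_derive1 (R : realType) (f g : R -> R) (x : R) :
  (\near x, f x = g x) -> derive1 f x = derive1 g x.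
Proof. by move=> fg; rewrite !derive1E; exact: near_eq_derive. Qed.

Lemma abs_continuous_density (R : realType) (u : R -> R) (a b : R) :
  a <= b -> abs_continuous a b u ->
  exists f : R -> R, lebesgue_measure.-integrable setT (EFin \o f) /\
    forall x y, a <= x -> x <= y -> y <= b ->
      u y - u x = \int[lebesgue_measure]_(t in `]x, y]) f t.
Proof.
move=> ab uac; pose V := variation_fun a b u.
pose W x := V x - u (clamp a b x).
have Vac : abs_continuousT V by exact: abs_continuousT_variation_fun.
have Vge x y : x <= y -> `|u (clamp a b y) - u (clamp a b x)| <= V y - V x.
  exact: variation_fun_ge.
have Vnd : {homo V : x y / x <= y}.
  by move=> x y /Vge h; rewrite -subr_ge0; apply: le_trans h.
have Wnd : {homo W : x y / x <= y}.
  move=> x y /Vge h; rewrite /W -subr_ge0.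
  by have := le_trans (ler_norm _) h; lra.
have Wac : abs_continuousT W.
  move=> e e0; have e20 : 0 < e / 2 by rewrite divr_gt0.
  have [d1 d10 H1] := Vac _ e20.
  have [d2 d20 H2] := abs_continuous_clamp ab uac e20.
  exists (Num.min d1 d2); first by rewrite lt_min d10.
  move=> T x y xy tI; rewrite lt_min => /andP[s1 s2].
  have {}H1 := H1 T x y xy tI s1; have {}H2 := H2 T x y xy tI s2.
  have := ltrD H1 H2; rewrite -splitr -big_split /=; apply: le_lt_trans.
  apply: ler_sum => i _; rewrite /W.
  rewrite (_ : _ - _ = V (y i) - V (x i) - (u (clamp a b (y i)) - u (clamp a b (x i)))).
    exact: ler_normB.
  by ring.
have [f1 [f10 f1i f1E]] := monotone_density Vnd Vac ab.
have [f2 [f20 f2i f2E]] := monotone_density Wnd Wac ab.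
exists (fun x => f1 x - f2 x); split.
  by apply: eq_integrable (integrableB _ f1i f2i) => //.
move=> x y ax xy yb.
have mxy : measurable (`]x, y]%classic : set R) by exact: measurable_itv.
rewrite RintegralB //; try exact: integrableS f1i || exact: integrableS f2i.
rewrite /Rintegral -f1E // -f2E // /= /W.
by rewrite !clamp_id ?ax ?yb ?(le_trans ax) ?(le_trans xy) //; ring.
Qed.

(** Near an interior point, [u] is [u a] plus the integral of its density, so Lebesgue's
    differentiation theorem gives the derivative almost everywhere. *)
Lemma abs_continuous_ae_derivable (R : realType) (u : R -> R) (a b : R) :
  a <= b -> abs_continuous a b u ->
  exists f : R -> R, [/\ lebesgue_measure.-integrable setT (EFin \o f),
    u b - u a = \int[lebesgue_measure]_(t in `]a, b]) f t &
    {ae lebesgue_measure, forall x, a < x < b -> derivable u x 1 /\ derive1 u x = f x}].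
Proof.
move=> ab uac; have [f [fi fE]] := abs_continuous_density ab uac.
exists f; split => //; first exact: fE.
have fi' y : lebesgue_measure.-integrable [set` Interval (BRight a) (BRight y)] (EFin \o f).
  exact: integrableS fi.
have fl : locally_integrable [set: R] f.
  by apply: open_integrable_locally => //; exact: openT.
move: (FTC1 fi' fl); apply: filterS; first exact: (ae_filter_ringOfSetsType (@lebesgue_measure R)).
move=> x Fx /andP[ax xb].
have [Fd FE] := Fx (ax : (BRight a < BRight x)%E).
set F := (fun x => _) in Fd FE.
have uF : \near x, u a + F x = u x.
  near=> y; rewrite /F -fE //; first by ring.
  - by apply/ltW; near: y; exact: lt_nbhsr.
  - by apply/ltW; near: y; exact: lt_nbhsl.
have Fd' : is_derive x 1 F (f x) by apply: (DeriveDef Fd); rewrite -derive1E; exact: FE.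
have := is_deriveD (is_derive_cst (u a) x 1) Fd'; rewrite add0r => aFd.
have [ud uE] := near_eq_is_derive uF aFd.
by split => //; rewrite derive1E.
Unshelve. all: by end_near. Qed.

Lemma abs_continuous_le_integral_derive1 (R : realType) (u : R -> R) (a b : R) :
  a <= b -> abs_continuous a b u -> measurable_fun `]a, b[ (derive1 u) ->
  (`|u b - u a|%:E <= \int[lebesgue_measure]_(t in `]a, b[) `|derive1 u t|%:E)%E.
Proof.
move=> ab uac mu; have [f [fi fE fae]] := abs_continuous_ae_derivable ab uac.
have mab : measurable (`]a, b]%classic : set R) by exact: measurable_itv.
have mab' : measurable (`]a, b[%classic : set R) by exact: measurable_itv.
have mf : measurable_fun setT f by apply/measurable_EFinP; exact: measurable_int fi.
have fiab : lebesgue_measure.-integrable `]a, b]%classic (EFin \o f) by exact: integrableS fi.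
rewrite fE EFin_normr_Rintegral // (le_trans (le_abse_integral _ _ _)) //.
  by apply/measurable_EFinP; exact: measurable_funTS.
rewrite [X in (X <= _)%E]integral_itv_bndoo; last first.
  by apply/measurable_EFinP; apply: measurableT_comp => //; exact: measurable_funTS.
rewrite le_eqVlt; apply/orP; left; apply/eqP.
apply: (@ge0_ae_eq_integral _ _ R lebesgue_measure _ (fun x => `|f x|%:E)
  (fun x => `|derive1 u x|%:E)) => //.
- by apply/measurable_EFinP; apply: measurableT_comp => //; exact: measurable_funTS.
- by apply/measurable_EFinP; apply: measurableT_comp.
move: fae; apply: filterS; first exact: (ae_filter_ringOfSetsType (@lebesgue_measure R)).
move=> x fx; rewrite /= in_itv /= => /fx[_ ->].
by [].
Qed.

(** * Measurability of the derivative *)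

Lemma exists_invn_lt (R : realType) (e : R) : 0 < e -> exists m : nat, m.+1%:R^-1 < e.
Proof.
move=> e0; exists (Num.bound e^-1).
rewrite invf_plt ?posrE ?ltr0n //.
apply: (lt_trans (archi_boundP (_ : 0 <= e^-1))); first by rewrite invr_ge0 ltW.
by rewrite ltr_nat.
Qed.

Lemma invn_gt0 (R : realType) (n : nat) : 0 < n.+1%:R^-1 :> R.
Proof. by rewrite invr_gt0 ltr0n. Qed.

(* Ranging over all real h and h' makes this set an intersection of closed sets,
   hence closed; differentiability is a countable combination of such sets. *)
Definition cauchy_quotient_set (R : realType) (v : R -> R) (k m : nat) : set R :=
  [set x | forall h h' : R, h != 0 -> h' != 0 ->
    `|h| < m.+1%:R^-1 -> `|h'| < m.+1%:R^-1 ->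
    `|h^-1 * (v (h + x) - v x) - h'^-1 * (v (h' + x) - v x)| <= k.+1%:R^-1].

Lemma closed_cauchy_quotient_set (R : realType) (v : R -> R) (k m : nat) :
  continuous v -> closed (cauchy_quotient_set v k m).
Proof.
move=> cv.
pose B (p : R * R) := [set x : R | p.1 != 0 -> p.2 != 0 ->
    `|p.1| < m.+1%:R^-1 -> `|p.2| < m.+1%:R^-1 ->
    `|p.1^-1 * (v (p.1 + x) - v x) - p.2^-1 * (v (p.2 + x) - v x)| <= k.+1%:R^-1].
have -> : cauchy_quotient_set v k m = \bigcap_p B p.
  apply/seteqP; split => [x H p _|x H h h'].
    by rewrite /B /=; exact: H.
  exact: (H (h, h') Logic.I).
apply: closed_bigI => -[h h'] _; rewrite /B /=.
have [[h0 h'0 hm h'm]|nh] := pselect [/\ h != 0, h' != 0, `|h| < m.+1%:R^-1 & `|h'| < m.+1%:R^-1]; last first.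
  rewrite (_ : mkset _ = setT); first exact: closedT.
  by apply/seteqP; split => // x _ a b c d; exfalso; apply: nh.
pose F x := `|h^-1 * (v (h + x) - v x) - h'^-1 * (v (h' + x) - v x)|.
have cq (l : R) : continuous (fun x => l^-1 * (v (l + x) - v x)).
  move=> x; apply: cvgM; first exact: cvg_cst.
  apply: cvgB; last exact: cv.
  apply: (@cvg_comp _ _ _ (fun x => l + x) v _ (nbhs (l + x))); last exact: cv.
  by apply: cvgD; [exact: cvg_cst|exact: cvg_id].
have cF : continuous F.
  by move=> x; apply: cvg_norm; apply: cvgB; exact: cq.
rewrite (_ : mkset _ = F @^-1` [set y | y <= k.+1%:R^-1]).
  by apply: closed_comp => [y _|]; [exact: cF|exact: closed_le].
by apply/seteqP; split => x /=; [apply|].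
Qed.

(** Cauchy's criterion for the difference quotient. Tolerances and radii of the form 1 / (n + 1)
    make it a countable condition in which no limit is named. *)
Lemma cvg_quotientP (R : realType) (v : R -> R) (x : R) :
  cvg (h^-1 *: (v (h + x) - v x) @[h --> 0^']) <->
  (\bigcap_k \bigcup_m cauchy_quotient_set v k m) x.
Proof.
split => [|H].
  move=> /cvg_ex[l /= ql] k _.
  have e0 : 0 < k.+1%:R^-1 / 2 :> R by rewrite divr_gt0 // invn_gt0.
  move/cvgrPdist_lt : ql => /(_ _ e0); rewrite /dnbhs near_withinE.
  move=> /nbhs_ballP[d /= d0 H]; have [m md] := exists_invn_lt d0.
  exists m => // h h' h0 h'0 hm h'm.
  have K g : g != 0 -> `|g| < m.+1%:R^-1 -> `|l - g^-1 * (v (g + x) - v x)| < k.+1%:R^-1 / 2.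
    move=> g0 gm; apply: (H g) => //; rewrite /ball /= sub0r normrN.
    exact: lt_trans md.
  rewrite (_ : _ - _ = (l - h'^-1 * (v (h' + x) - v x)) - (l - h^-1 * (v (h + x) - v x))).
    by rewrite (le_trans (ler_normB _ _)) // ltW // [ltRHS]splitr ltrD // K.
  by ring.
apply: R_complete; apply/cauchyP => e e0; have [k ke] := exists_invn_lt e0.
have [m _ Hm] := H k Logic.I.
(* The step 1 / (m + 2) satisfies the strict bound 1 / (m + 1), so the quotient with this step can
   serve as the centre of the Cauchy ball. *)
have a0 : 0 < m.+2%:R^-1 :> R by exact: invn_gt0.
exists ((m.+2%:R^-1)^-1 * (v (m.+2%:R^-1 + x) - v x)).
change (nbhs (0 : R) (fun h => h != 0 -> ball (m.+2%:R^-1^-1 * (v (m.+2%:R^-1 + x) - v x))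
  e (h^-1 *: (v (h + x) - v x)))); apply/nbhs_ballP; exists m.+1%:R^-1 => /=.
  exact: invn_gt0.
move=> h; rewrite /ball /= sub0r normrN => hm h0.
apply: le_lt_trans ke; apply: Hm => //.
by rewrite gtr0_norm // ltf_pV2 ?posrE ?ltr0n // ltr_nat.
Qed.

(** On the set [D] where the quotient converges, the derivative is the limit of the continuous
    quotients with step 1 / (n + 1); off [D] it is the default value [point]. *)
Lemma measurable_derive1 (R : realType) (v : R -> R) :
  continuous v -> measurable_fun setT (derive1 v).
Proof.
move=> cv; pose D := \bigcap_k \bigcup_m cauchy_quotient_set v k m.
have mD : measurable D.
  apply: bigcap_measurable => // k _; apply: bigcup_measurable => m _.
  by apply: closed_measurable; exact: closed_cauchy_quotient_set.
rewrite -(setUv D); apply/measurable_funU => //; first exact: measurableC.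
split.
  pose q n x := (n.+1%:R^-1)^-1 *: (v (n.+1%:R^-1 + x) - v x).
  apply: (@measurable_fun_cvg _ _ _ D q) => [n|x Dx].
    apply: measurable_funTS; apply: continuous_measurable_fun => x.
    apply: cvgM; first exact: cvg_cst.
    apply: cvgB; last exact: cv.
    apply: (@cvg_comp _ _ _ (fun x => n.+1%:R^-1 + x) v _ (nbhs (n.+1%:R^-1 + x))); last exact: cv.
    by apply: cvgD; [exact: cvg_cst|exact: cvg_id].
  move/cvg_quotientP : Dx => Dx.
  apply: (@cvg_comp _ _ _ (fun n => n.+1%:R^-1 : R)
    (fun h => h^-1 *: (v (h + x) - v x)) _ (0^')); last exact: Dx.
  move=> A; rewrite /dnbhs /= => /nbhs_ballP[d /= d0 H].
  have [m md] := exists_invn_lt d0; exists m => // n /= mn.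
  apply: H; last by rewrite gt_eqF // invn_gt0.
  rewrite /ball /= sub0r normrN gtr0_norm ?invn_gt0 //; apply: le_lt_trans md.
  by rewrite lef_pV2 ?posrE ?ltr0n // ler_nat.
apply: (@eq_measurable_fun _ _ _ _ _ (cst point)).
  move=> x; rewrite inE => nDx; rewrite /derive1 dvgP //.
  by move=> /cvg_quotientP.
exact: measurable_cst.
Qed.

(** The derivative is local: above c = 1 / (n + 1) it is that of [v \o Num.max c], which is
    continuous on the whole line. *)
Lemma measurable_derive1_pos (R : realType) (v : R -> R) :
  (forall x, 0 < x -> {for x, continuous v}) ->
  measurable_fun (`]0, +oo[ : set R) (derive1 v).
Proof.
move=> cv.
have -> : `]0, +oo[%classic = \bigcup_n `]n.+1%:R^-1, +oo[%classic :> set R.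
  apply/seteqP; split => x /=; rewrite in_itv /= andbT => x0.
    have [n nx] := exists_invn_lt x0; exists n => //=.
    by rewrite in_itv /= andbT.
  case: x0 => n _ /=; rewrite !in_itv /= !andbT; apply: lt_trans.
  exact: invn_gt0.
apply/measurable_fun_bigcup => [n|n]; first exact: measurable_itv.
set c := n.+1%:R^-1 : R.
have c0 : 0 < c by rewrite invr_gt0 ltr0n.
apply: (@eq_measurable_fun _ _ _ _ _ (derive1 (v \o Num.max c))).
  move=> x; rewrite inE /= in_itv /= andbT => cx.
  apply: near_eq_derive1; near=> y => /=; rewrite max_r //.
  by apply: ltW; near: y; exact: lt_nbhsr.
apply: measurable_funTS; apply: measurable_derive1 => x.
apply: continuous_comp; last by apply: cv; rewrite lt_max c0.
apply/cvgrPdist_lt => e e0; near=> y.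
have xy : `|x - y| < e by near: y; exact: cvgr_dist_lt.
apply: le_lt_trans xy; rewrite /Num.max.
have := ler_norm (x - y); have := ler_norm (y - x); rewrite distrC.
by do ! case: ifPn; rewrite -?leNgt ler_norml; lra.
Unshelve. all: by end_near. Qed.

(** * The logarithmic energy *)

Lemma integral_FTC_pos (R : realType) (F f : R -> R) (a b : R) :
  (forall x : R, 0 < x -> is_derive x 1 F (f x)) ->
  (forall x : R, 0 < x -> {for x, continuous f}) -> 0 < a -> a < b ->
  (\int[lebesgue_measure]_(x in `]a, b[) (f x)%:E)%E = (F b - F a)%:E.
Proof.
move=> dF cf a0 ab.
have mf : measurable_fun (`]a, b[ : set R) (EFin \o f).
  apply/measurable_EFinP; apply: open_continuous_measurable_fun.
    exact: interval_open.
  by move=> x; rewrite inE /= in_itv /= => /andP[ax _]; apply: cf; exact: lt_trans ax.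
have cF (x : R) : 0 < x -> {for x, continuous F}.
  by move=> x0; apply/differentiable_continuous/derivable1_diffP; case: (dF x x0).
rewrite -(integral_itv_bndoo true false) // (@continuous_FTC2 _ _ F) //.
- apply: continuous_in_subspaceT => x; rewrite inE /= in_itv /= => /andP[ax _].
  by apply: cf; exact: lt_le_trans ax.
- split.
  + by move=> x; rewrite in_itv /= => /andP[ax _]; case: (dF x) => //; exact: lt_trans ax.
  + by apply: cvg_at_right_filter; exact: cF.
  + by apply: cvg_at_left_filter; apply: cF; exact: lt_trans ab.
- move=> x; rewrite in_itv /= => /andP[ax _]; rewrite derive1E.
  by have [_ ->] := dF x (lt_trans a0 ax).
Qed.

Lemma integral_inv (R : realType) (a b : R) : 0 < a -> a < b ->
  (\int[lebesgue_measure]_(x in `]a, b[) (x^-1)%:E)%E = (ln b - ln a)%:E.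
Proof.
move=> a0 ab; apply: (@integral_FTC_pos R (@ln R) (fun x => x^-1)) => // x x0.
by apply: cvgV; [rewrite gt_eqF|exact: cvg_id].
Qed.

(* Riesz' description of the p-energy in the variable ln r: for alpha = p - 1 it
   says that the integral of |v'|^p r^alpha is at most C, without mentioning v',
   and it passes to pointwise limits.  Terms with x i = y i are 0 / 0 = 0. *)
Definition log_energy_le (R : realType) (p C : R) (v : R -> R) : Prop :=
  forall (T : finType) (x y : T -> R), (forall i, 0 < x i <= y i) ->
    trivIset setT (fun i => `]x i, y i[%classic) ->
    \sum_i `|v (y i) - v (x i)| `^ p / (ln (y i) - ln (x i)) `^ (p - 1) <= C.

Lemma sum_integral_oo_le (R : realType) (T : finType) (x y : T -> R) (g : R -> R) :
  (forall r, 0 < r -> 0 <= g r) -> measurable_fun (`]0, +oo[ : set R) g ->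
  (forall i, 0 < x i) ->
  trivIset setT (fun i => `]x i, y i[%classic) ->
  (\sum_i \int[lebesgue_measure]_(r in `]x i, y i[) (g r)%:E <=
   \int[lebesgue_measure]_(r in `]0%R, +oo[) (g r)%:E)%E.
Proof.
move=> g0 mg x0 tI; pose F i := `]x i, y i[%classic.
have sub : \big[setU/set0]_(i <- index_enum T) F i `<=` `]0, +oo[%classic.
  move=> r; rewrite -bigcup_seq => -[i _]; rewrite /F /= !in_itv /= andbT => /andP[xr _].
  exact: lt_trans xr.
have mB : measurable (\big[setU/set0]_(i <- index_enum T) F i).
  by apply: bigsetU_measurable => i _; exact: measurable_itv.
have mg' : measurable_fun (`]0, +oo[ : set R) (EFin \o g) by exact/measurable_EFinP.
have m0 : measurable (`]0, +oo[%classic : set R) by exact: measurable_itv.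
rewrite -(@ge0_integral_bigsetU _ _ R lebesgue_measure _ F (EFin \o g) (index_enum T)).
- apply: ge0_subset_integral => //.
  by move=> r /=; rewrite in_itv /= andbT lee_fin; exact: g0.
- by move=> n; exact: measurable_itv.
- exact: index_enum_uniq.
- by apply: sub_trivIset tI.
- exact: measurable_funS mg'.
- by move=> r /sub /=; rewrite in_itv /= andbT lee_fin; exact: g0.
Qed.

(** The tangent bound for the convex function x^p at the point m, obtained from Young's inequality
    for x and m^(p - 1). Equality holds at x = m, so the slope can be recovered without loss. *)
Lemma young_powR (R : realType) (p x m : R) : 1 < p -> 0 <= x -> 0 <= m ->
  p * m `^ (p - 1) * x <= x `^ p + (p - 1) * m `^ p.
Proof.
move=> p1 x0 m0.
have p0 : 0 < p by lra.
have p10 : 0 < p - 1 by lra.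
have q0 : 0 < p / (p - 1) by rewrite divr_gt0.
have pq : p^-1 + (p / (p - 1))^-1 = 1 by field; rewrite !gt_eqF.
have := conjugate_powR x0 (powR_ge0 m (p - 1)) p0 q0 pq.
rewrite -powRrM (_ : (p - 1) * (p / (p - 1)) = p); last by field; rewrite gt_eqF.
rewrite -(ler_pM2l p0) => H.
rewrite (_ : p * m `^ (p - 1) * x = p * (x * m `^ (p - 1))); last by ring.
rewrite (_ : x `^ p + _ = p * (x `^ p / p + m `^ p / (p / (p - 1)))) //.
by field; rewrite !gt_eqF.
Qed.

(* Young's inequality for the integrand s |u' s| against the slope
   m = |u b - u a| / (ln b - ln a), integrated against ds / s. *)
Lemma energy_interval_le (R : realType) (p a b : R) (u : R -> R) :
  1 < p -> 0 < a -> a < b -> abs_continuous a b u ->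
  measurable_fun (`]0, +oo[ : set R) (derive1 u) ->
  ((`|u b - u a| `^ p / (ln b - ln a) `^ (p - 1))%:E <=
   \int[lebesgue_measure]_(r in `]a, b[) (`|derive1 u r| `^ p * r `^ (p - 1))%:E)%E.
Proof.
move=> p1 a0 ab uac mu.
set A := `|u b - u a|; set L := ln b - ln a.
have L0 : 0 < L by rewrite subr_gt0 ltr_ln // posrE // (lt_trans a0).
have A0 : 0 <= A by exact: normr_ge0.
pose m := A / L.
have m0 : 0 <= m by rewrite divr_ge0 // ltW.
have AE : A `^ p / L `^ (p - 1) = m `^ p * L.
  rewrite (_ : A = m * L) /m; last by rewrite divfK // gt_eqF.
  rewrite powRM // ?(ltW L0) // -[in L `^ p](mulr_powRB1 (ltW L0)); last by lra.
  by rewrite mulrA mulfK // gt_eqF // powR_gt0.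
have sub : `]a, b[%classic `<=` `]0, +oo[%classic.
  by move=> r /=; rewrite !in_itv /= andbT => /andP[ar _]; exact: lt_trans ar.
have mab : measurable (`]a, b[%classic : set R) by exact: measurable_itv.
have mu' : measurable_fun (`]a, b[ : set R) (derive1 u) by exact: measurable_funS mu.
have mnu : measurable_fun (`]a, b[ : set R) (fun r => `|derive1 u r|).
  exact: measurableT_comp mu'.
have mE : measurable_fun (`]a, b[ : set R) (fun r => `|derive1 u r| `^ p * r `^ (p - 1)).
  apply: measurable_funM.
    exact: (measurableT_comp (measurable_powR _)) mnu.
  by apply: measurable_funTS; exact: measurable_powR.
have minv : measurable_fun (`]a, b[ : set R) (fun r => r^-1).
  apply: open_continuous_measurable_fun; first exact: interval_open.
  move=> x; rewrite inE /= in_itv /= => /andP[ax _].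
  by apply: cvgV; [rewrite gt_eqF // (lt_trans a0)|exact: cvg_id].
have H1 := abs_continuous_le_integral_derive1 (ltW ab) uac mu'.
set E := (X in (_ <= X)%E).
have E0 : (0 <= E)%E.
  by apply: integral_ge0 => r _; rewrite lee_fin mulr_ge0 // powR_ge0.
set D := integral _ _ _ in H1.
have c10 : 0 <= p * m `^ (p - 1) by rewrite mulr_ge0 ?powR_ge0 //; lra.
have c20 : 0 <= (p - 1) * m `^ p by rewrite mulr_ge0 ?powR_ge0 //; lra.
have key : ((p * m `^ (p - 1))%:E * D <= E + ((p - 1) * m `^ p * L)%:E)%E.
  rewrite [((p - 1) * m `^ p * L)%:E]EFinM.
  have -> : L%:E = (\int[lebesgue_measure]_(x in `]a, b[) (x^-1)%:E)%E.
    by rewrite integral_inv.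
  have inv0 x : x \in `]a, b[ -> 0 <= x^-1.
    by move=> /sub /=; rewrite in_itv /= andbT => x0; rewrite invr_ge0 ltW.
  rewrite /D /E -ge0_integralZl_EFin //; last first.
    exact/measurable_EFinP.
  rewrite -[X in (_ <= _ + X)%E]ge0_integralZl_EFin //; last first.
    exact/measurable_EFinP.
  rewrite -ge0_integralD //; first last.
  - by apply/measurable_EFinP; apply: measurable_funM.
  - by move=> x xab; rewrite -EFinM lee_fin mulr_ge0 // inv0.
  - exact/measurable_EFinP.
  - by move=> x _; rewrite lee_fin mulr_ge0 // powR_ge0.
  apply: ge0_le_integral => //.
  - by move=> x _; rewrite -EFinM lee_fin mulr_ge0.
  - by apply/measurable_EFinP; apply: measurable_funM.
  - by apply/measurable_EFinP; apply: measurable_funD => //; apply: measurable_funM.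
  move=> x /sub /=; rewrite in_itv /= andbT => x0; rewrite -!EFinM -EFinD lee_fin.
  have xu : 0 <= x * `|derive1 u x| by rewrite mulr_ge0 // ltW.
  have := young_powR p1 xu m0.
  rewrite powRM // ?(ltW x0) // -[in x `^ p](mulr_powRB1 (ltW x0)); last by lra.
  move=> H; rewrite -(ler_pM2r x0); move: H; congr (is_true (_ <= _)); first by ring.
  by field; rewrite gt_eqF.
have {}H1 : ((p * m `^ p * L)%:E <= E + ((p - 1) * m `^ p * L)%:E)%E.
  apply: le_trans key; rewrite (_ : p * m `^ p * L = p * m `^ (p - 1) * A).
    by rewrite EFinM; apply: lee_wpmul2l.
  rewrite -(mulr_powRB1 m0); last by lra.
  have -> : A = m * L by rewrite /m divfK // gt_eqF.
  by ring.
(* An infinite [E] leaves nothing to show; otherwise the finite term (p - 1) m^p L is subtracted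
   from both sides. *)
rewrite AE; move: (E) H1 E0 => [e|_ _|//]; last by rewrite leey.
by rewrite -EFinD !lee_fin => ? _; lra.
Qed.

Lemma log_energy_of_derive1 (R : realType) (p C : R) (u : R -> R) : 1 < p ->
  loc_abs_continuous u -> measurable_fun (`]0, +oo[ : set R) (derive1 u) ->
  (\int[lebesgue_measure]_(r in `]0%R, +oo[) (`|derive1 u r| `^ p * r `^ (p - 1))%:E <= C%:E)%E ->
  log_energy_le p C u.
Proof.
move=> p1 uac mu uC T x y xy tI; rewrite -lee_fin; apply: le_trans uC.
have mE : measurable_fun (`]0, +oo[ : set R) (fun r => `|derive1 u r| `^ p * r `^ (p - 1)).
  apply: measurable_funM; last by apply: measurable_funTS; exact: measurable_powR.
  apply: (measurableT_comp (measurable_powR _)).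
  exact: measurableT_comp mu.
apply: le_trans (sum_integral_oo_le _ mE _ tI); last 2 first.
- by move=> r _; rewrite mulr_ge0 // powR_ge0.
- by move=> i; have /andP[] := xy i.
rewrite -sumEFin; apply: lee_sum => i _; have /andP[xi] := xy i.
rewrite le_eqVlt => /predU1P[<-|xyi].
  have p0 : p != 0 by rewrite gt_eqF //; lra.
  rewrite subrr normr0 powR0 // mul0r.
  by apply: integral_ge0 => r _; rewrite lee_fin mulr_ge0 // powR_ge0.
by apply: energy_interval_le => //; exact: uac.
Qed.

(** Fatou's lemma, with the condition that the lower limit of [f n] is at least [g] spelled out
    through tolerances. Grid functions, truncations and pointwise limits all deliver it in this
    form. *)
Lemma fatou_le (R : realType) (D : set R) (f : nat -> R -> R) (g : R -> R) (C : \bar R) :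
  measurable D -> (forall n, measurable_fun D (f n)) -> measurable_fun D g ->
  (forall n x, D x -> 0 <= f n x) -> (forall x, D x -> 0 <= g x) ->
  (forall x (e : R), D x -> 0 < e -> \forall n \near \oo, g x - e <= f n x) ->
  (forall n, (\int[lebesgue_measure]_(x in D) (f n x)%:E <= C)%E) ->
  (\int[lebesgue_measure]_(x in D) (g x)%:E <= C)%E.
Proof.
move=> mD mf mg f0 g0 fg fC.
have mf' n : measurable_fun D (EFin \o f n) by exact/measurable_EFinP.
have f0' n x : D x -> (0 <= (f n x)%:E)%E by move=> Dx; rewrite lee_fin f0.
have := fatou (@lebesgue_measure R) mD mf' f0'.
move=> /(le_trans _) H.
apply: (@le_trans _ _ (limn_einf (fun n => \int[lebesgue_measure]_(x in D) (f n x)%:E)%E)).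
  apply: H; apply: ge0_le_integral => //.
  - exact/measurable_EFinP.
  - apply: (@emeasurable_fun_cvg _ _ _ _ (fun n x => einfs (fun k => (f k x)%:E) n)).
      by move=> m; exact: (measurable_fun_einfs mf').
    by move=> x Dx; rewrite limn_einf_lim; exact: is_cvg_einfs.
  move=> x Dx; apply/lee_addgt0Pr => e e0; rewrite limn_einf_lim.
  rewrite -leeBlDr //; apply: lime_ge; first exact: is_cvg_einfs.
  have [N _ HN] := fg x e Dx e0.
  exists N => // n /= Nn; apply: le_ereal_inf_tmp => _ [k /= nk <-].
  by rewrite -EFinB lee_fin; apply: HN; exact: leq_trans nk.
rewrite limn_einf_lim; apply: lime_le; first exact: is_cvg_einfs.
apply: nearW => n; apply: le_trans (fC n).
by apply: ereal_inf_lbound; exists n => /=.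
Qed.

(** Differentiability at [r] controls the two increments v (y n) - v r and v (x n) - v r by [e]
    times their distances to [r]; as [r] lies between the ends, these distances add up to y n - x
    n. *)
Lemma straddle (R : realType) (v : R -> R) (r : R) (x y : nat -> R) :
  derivable v r 1 -> (forall n, x n <= r < y n) ->
  (y n - x n) @[n --> \oo] --> (0 : R) ->
  ((v (y n) - v (x n)) / (y n - x n)) @[n --> \oo] --> derive1 v r.
Proof.
move=> dv xry d0; apply/cvgrPdist_le => e e0.
have : h^-1 *: (v (h + r) - v r) @[h --> 0^'] --> derive1 v r.
  suff: cvg (h^-1 *: (v (h + r) - v r) @[h --> 0^']) by [].
  move: dv; rewrite /derivable /=.
  by under eq_fun do rewrite [_%:A]mulr1.
move=> /cvgrPdist_le/(_ e e0); rewrite /dnbhs near_withinE => /nbhs_ballP[d /= dp H].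
have K h : `|h| < d -> `|v (h + r) - v r - h * derive1 v r| <= e * `|h|.
  have [->|h0] := eqVneq h 0; first by rewrite add0r subrr mul0r subr0 normr0 mulr0.
  move=> hd; have : ball 0 d h by rewrite /ball /= sub0r normrN.
  move=> /H/(_ h0); rewrite /= -(ler_pM2r (_ : 0 < `|h|)) ?normr_gt0 //.
  rewrite -normrM mulrBl [_ *: _]mulrC mulfVK // distrC.
  by rewrite [derive1 v r * h]mulrC.
near=> n.
have dn : `|0 - (y n - x n)| < d by near: n; exact: cvgr_dist_lt.
have /andP[xr ry] := xry n.
have yx : 0 < y n - x n by lra.
move: dn; rewrite sub0r normrN gtr0_norm // => dn.
have := K (y n - r); rewrite subrK ger0_norm; last by lra.
have := K (x n - r); rewrite subrK ler0_norm; last by lra.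
move=> /(_ _)/ler_normlP; case; first by lra.
move=> h1 h2 /(_ _)/ler_normlP; case; first by lra.
move=> h3 h4; rewrite -(ler_pM2r yx) -[X in _ * X <= _](gtr0_norm yx) -normrM mulrBl divfK ?gt_eqF //.
by apply/ler_normlP; split; nra.
Unshelve. all: by end_near. Qed.

Lemma powR_cvg (R : realType) (a : nat -> R) (l s : R) : 0 < l ->
  a n @[n --> \oo] --> l -> (a n `^ s) @[n --> \oo] --> l `^ s.
Proof.
move=> l0 al.
have cp : {for l, continuous (fun x : R => x `^ s)}.
  apply/differentiable_continuous/derivable1_diffP.
  by case: (is_derive1_powR s l0).
by apply: (@cvg_comp _ _ _ a (fun x => x `^ s) _ (nbhs l)).
Qed.

(** The term of [log_energy_le] for [x, y], spread evenly over that interval: multiplied by y - x it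
    gives the term back. *)
Definition grid_slope (R : realType) (p : R) (v : R -> R) (x y : R) : R :=
  `|v y - v x| `^ p / ((ln y - ln x) `^ (p - 1) * (y - x)).

Lemma grid_slope_cvg (R : realType) (p : R) (v : R -> R) (r : R) (x y : nat -> R) :
  1 < p -> 0 < r -> derivable v r 1 -> (forall n, x n <= r < y n) ->
  (y n - x n) @[n --> \oo] --> (0 : R) -> derive1 v r != 0 ->
  grid_slope p v (x n) (y n) @[n --> \oo] --> `|derive1 v r| `^ p * r `^ (p - 1).
Proof.
move=> p1 r0 dv xry d0 v0.
have dln : derivable (@ln R) r 1 by case: (is_derive1_ln r0).
have dlnE : derive1 (@ln R) r = r^-1.
  by rewrite derive1E; case: (is_derive1_ln r0).
have A := straddle dv xry d0; have := straddle dln xry d0; rewrite dlnE => B.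
have A' : `|(v (y n) - v (x n)) / (y n - x n)| `^ p @[n --> \oo] --> `|derive1 v r| `^ p.
  by apply: powR_cvg; [rewrite normr_gt0|exact: cvg_norm].
have B' : ((ln (y n) - ln (x n)) / (y n - x n)) `^ (1 - p) @[n --> \oo] --> r^-1 `^ (1 - p).
  by apply: powR_cvg => //; rewrite invr_gt0.
have : (`|(v (y n) - v (x n)) / (y n - x n)| `^ p *
    ((ln (y n) - ln (x n)) / (y n - x n)) `^ (1 - p)) @[n --> \oo] -->
    `|derive1 v r| `^ p * r^-1 `^ (1 - p) by exact: cvgM.

rewrite -[r^-1](powR_inv1 (ltW r0)) -powRrM (_ : -1 * (1 - p) = p - 1); last by ring.
apply: cvg_trans; apply: near_eq_cvg; near=> n.
have /andP[xr ry] := xry n.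
have yx : 0 < y n - x n by lra.
have x0 : 0 < x n.
  have : `|0 - (y n - x n)| < r by near: n; exact: cvgr_dist_lt.
  by rewrite sub0r normrN gtr0_norm //; lra.
have l0 : 0 < ln (y n) - ln (x n).
  by rewrite subr_gt0 ltr_ln ?posrE //; lra.
rewrite /grid_slope (_ : 1 - p = - (p - 1)); last by ring.
rewrite powRN normrM normfV (gtr0_norm yx) !powRM ?invr_ge0 ?(ltW l0) ?(ltW yx) //.
rewrite -![(y n - x n)^-1](powR_inv1 (ltW yx)) -!powRrM !mulN1r !powRN.
rewrite -[in LHS](mulr_powRB1 (ltW yx)); last by lra.
have q0 : 0 < (y n - x n) `^ (p - 1) by exact: powR_gt0.
have q1 : 0 < (ln (y n) - ln (x n)) `^ (p - 1) by exact: powR_gt0.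
by field; rewrite !gt_eqF.
Unshelve. all: by end_near. Qed.

(** * Regularity of functions of finite logarithmic energy *)

Lemma log_energy_modulus (R : realType) (p C : R) (v : R -> R) (a b : R) :
  1 < p -> 0 <= C -> log_energy_le p C v -> 0 < a -> a <= b ->
  `|v b - v a| <= C `^ p^-1 * (ln b - ln a) `^ ((p - 1) / p).
Proof.
move=> p1 C0 vC a0; have p0 : 0 < p by lra.
rewrite le_eqVlt => /predU1P[<-|ab].
  by rewrite !subrr normr0 mulr_ge0 // powR_ge0.
have L0 : 0 < ln b - ln a by rewrite subr_gt0 ltr_ln // posrE // (lt_trans a0).
have tI : trivIset setT (fun _ : unit => `]a, b[%classic : set R) by apply/trivIsetP => -[] [].
have xy (i : unit) : 0 < a <= b by rewrite a0 ltW.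
(* The energy inequality for the family that consists of ]a, b[ alone; the claim is its p-th
   root. *)
have := vC unit (fun=> a) (fun=> b) xy tI.
rewrite big_const card_unit /= addr0 ler_pdivrMr ?powR_gt0 // => H.
have -> : `|v b - v a| = (`|v b - v a| `^ p) `^ p^-1.
  by rewrite -powRrM divff ?gt_eqF // powRr1.
apply: (le_trans (ge0_ler_powR _ _ _ H)); rewrite ?nnegrE ?mulr_ge0 ?powR_ge0 //.
  by rewrite invr_ge0 ltW.
by rewrite powRM ?powR_ge0 // -powRrM.
Qed.

(** Separates energy from length. The slope [c] solves e c^(p - 1) = 1: if A / L <= c then A <= c L,
    and otherwise A is at most e times A (A / L)^(p - 1), which is the energy term. *)
Lemma powR_split (R : realType) (p e A L : R) : 1 < p -> 0 < e -> 0 <= A -> 0 < L ->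
  A <= e * (A `^ p / L `^ (p - 1)) + e^-1 `^ (p - 1)^-1 * L.
Proof.
move=> p1 e0 A0 L0; have p10 : 0 < p - 1 by lra.
set c := e^-1 `^ _.
have c0 : 0 <= c by exact: powR_ge0.
have [Ac|cA] := leP (A / L) c.
  rewrite -[leLHS](divfK (lt0r_neq0 L0)) -[leLHS]add0r lerD //.
    by rewrite mulr_ge0 ?(ltW e0) // divr_ge0 // powR_ge0.
  by rewrite ler_wpM2r // ltW.
have m0 : 0 <= A / L by rewrite divr_ge0 // ltW.
have mp : e^-1 <= (A / L) `^ (p - 1).
  rewrite (_ : e^-1 = c `^ (p - 1)).
    by rewrite ge0_ler_powR ?nnegrE ?(ltW cA) // ltW.
  by rewrite /c -powRrM mulVf ?gt_eqF // powRr1 // invr_ge0 ltW.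
have AE : A `^ p / L `^ (p - 1) = A * (A / L) `^ (p - 1).
  rewrite powRM ?invr_ge0 ?(ltW L0) // -[in RHS](powR_inv1 (ltW L0)) -powRrM mulN1r powRN.
  by rewrite mulrA mulr_powRB1 //; lra.
rewrite AE -[leLHS]addr0 lerD ?mulr_ge0 // ?(ltW L0) //.
rewrite mulrCA ler_peMr // -[leLHS](mulfV (lt0r_neq0 e0)).
by rewrite ler_wpM2l // ltW.
Qed.

Lemma ler_lnB (R : realType) (a x y : R) : 0 < a -> a <= x -> x <= y ->
  ln y - ln x <= (y - x) / a.
Proof.
move=> a0 ax xy; have x0 : 0 < x by exact: lt_le_trans ax.
have y0 : 0 < y by exact: lt_le_trans xy.
rewrite -ln_div ?posrE //.
rewrite (_ : y / x = 1 + (y - x) / x); last by field; rewrite gt_eqF.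
have yx : 0 <= (y - x) / x by rewrite divr_ge0 ?subr_ge0 // ltW.
apply: (le_trans (le_ln1Dx _)); first by apply: lt_le_trans yx; lra.
by rewrite ler_wpM2l ?subr_ge0 // lef_pV2 ?posrE.
Qed.

Lemma log_energy_sum_le (R : realType) (p C e : R) (v : R -> R) (T : finType)
    (a : R) (x y : T -> R) : 1 < p -> 0 < e -> log_energy_le p C v -> 0 < a ->
  (forall i, a <= x i <= y i) -> trivIset setT (fun i => `]x i, y i[%classic) ->
  \sum_i `|v (y i) - v (x i)| <=
    e * C + e^-1 `^ (p - 1)^-1 / a * \sum_i (y i - x i).
Proof.
move=> p1 e0 vC a0 xy tI.
apply: (@le_trans _ _ (\sum_i (e * (`|v (y i) - v (x i)| `^ p /
   (ln (y i) - ln (x i)) `^ (p - 1)) + e^-1 `^ (p - 1)^-1 / a * (y i - x i)))).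
  apply: ler_sum => i _; have /andP[ax] := xy i.
  have x0 : 0 < x i by exact: lt_le_trans ax.
  rewrite le_eqVlt => /predU1P[<-|xyi].
    by rewrite !subrr normr0 mulr0 addr0 mulr_ge0 ?(ltW e0) // divr_ge0 ?powR_ge0.
  have L0 : 0 < ln (y i) - ln (x i) by rewrite subr_gt0 ltr_ln // posrE // (lt_trans x0).
  apply: (le_trans (powR_split p1 e0 (normr_ge0 _) L0)).
  rewrite lerD2l -mulrA ler_wpM2l ?powR_ge0 // mulrC.
  by apply: ler_lnB => //; exact: ltW.
rewrite big_split /= -!mulr_sumr lerD2r ler_wpM2l ?(ltW e0) //.
by apply: vC => // i; have /andP[ax ->] := xy i; rewrite (lt_le_trans a0 ax).
Qed.

Lemma log_energy_loc_abs_continuous (R : realType) (p C : R) (v : R -> R) :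
  1 < p -> 0 <= C -> log_energy_le p C v -> loc_abs_continuous v.
Proof.
move=> p1 C0 vC a b a0 ab e e0.
(* With this [eta] the energy part of the bound is at most e / 2, and a short family then makes the
   length part less than e / 2. C + 1 keeps the denominator positive when C = 0. *)
pose eta := e / (2 * (C + 1)).
have eta0 : 0 < eta by rewrite divr_gt0 // mulr_gt0 //; lra.
pose c := eta^-1 `^ (p - 1)^-1 / a.
have c0 : 0 < c by rewrite divr_gt0 // powR_gt0 // invr_gt0.
exists (e / (2 * c)); first by rewrite divr_gt0 // mulr_gt0.
move=> n x y xy tI sd.
have xy' i : a <= x i <= y i by have [-> -> _] := xy i.
apply: (le_lt_trans (log_energy_sum_le p1 eta0 vC a0 xy' tI)).
rewrite -/c [ltRHS]splitr ler_ltD //.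
  rewrite /eta invfM mulrA -mulrA ler_piMr ?divr_ge0 ?(ltW e0) //.
  by rewrite mulrC ler_pdivrMr; lra.
rewrite -(ltr_pM2l c0) in sd; apply: (lt_le_trans sd).
by rewrite le_eqVlt; apply/orP; left; apply/eqP; field; rewrite gt_eqF.
Qed.

Lemma log_energy_continuous (R : realType) (p C : R) (v : R -> R) (x : R) :
  1 < p -> 0 <= C -> log_energy_le p C v -> 0 < x -> {for x, continuous v}.
Proof.
move=> p1 C0 vC x0; have x20 : 0 < x / 2 by rewrite divr_gt0.
have x2 : x / 2 < x * 2 by lra.
have /(abs_continuous_clamp (ltW x2))/abs_continuousT_continuous/(_ x) :=
  log_energy_loc_abs_continuous p1 C0 vC x20 x2.
rewrite /continuous_at /= clamp_id; last by lra.
apply: cvg_trans; apply: near_eq_cvg; near=> y.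
rewrite /= clamp_id //; apply/andP; split; apply/ltW; near: y.
  by apply: lt_nbhsr; lra.
by apply: lt_nbhsl; lra.
Unshelve. all: by end_near. Qed.

(* Fatou's lemma for step functions on the grid of mesh 1 / (n + 1), whose cells
   start at 1 / (n + 1) and exhaust ]0, +oo[.  Where v is not differentiable,
   derive1 v has the junk value 0. *)
Lemma log_energy_derive1_le (R : realType) (p C : R) (v : R -> R) :
  1 < p -> 0 <= C -> log_energy_le p C v ->
  (\int[lebesgue_measure]_(r in `]0%R, +oo[) (`|derive1 v r| `^ p * r `^ (p - 1))%:E <= C%:E)%E.
Proof.
move=> p1 C0 vC; have p0 : 0 < p by lra.
have mv' : measurable_fun (`]0, +oo[ : set R) (derive1 v).
  by apply: measurable_derive1_pos => x x0; exact: log_energy_continuous vC x0.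
(* The shift of the index keeps the left end of every cell positive, as [log_energy_le] demands;
   with (n + 1)^2 cells the grid reaches beyond n + 1. *)
pose X n (i : 'I_(n.+1 * n.+1)) : R := i.+1%:R / n.+1%:R.
pose Y n (i : 'I_(n.+1 * n.+1)) : R := i.+2%:R / n.+1%:R.
have X0 n i : 0 < X n i by rewrite divr_gt0 // ltr0n.
have XY n i : X n i < Y n i by rewrite ltr_pM2r ?invr_gt0 ?ltr0n // ltr_nat.
have slope0 n i : 0 <= grid_slope p v (X n i) (Y n i).
  by rewrite divr_ge0 ?powR_ge0 // mulr_ge0 ?powR_ge0 // subr_ge0 ltW.
have mI n i : measurable (`[X n i, Y n i[%classic : set R) by exact: measurable_itv.
have m0 : measurable (`]0, +oo[%classic : set R) by exact: measurable_itv.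
pose f n (r : R) : R := \sum_i grid_slope p v (X n i) (Y n i) * \1_(`[X n i, Y n i[%classic) r.
have term0 n i r : 0 <= grid_slope p v (X n i) (Y n i) * \1_(`[X n i, Y n i[%classic) r.
  by rewrite mulr_ge0 // indicE ler0n.
have mterm n i : measurable_fun (`]0, +oo[ : set R)
    (fun r => grid_slope p v (X n i) (Y n i) * \1_(`[X n i, Y n i[%classic) r).
  by apply: measurable_funM => //; apply: measurable_funTS; exact: measurable_indic.
apply: (@fatou_le _ _ f) => //.
- by move=> n; apply: measurable_sum => i.
- apply: measurable_funM; last by apply: measurable_funTS; exact: measurable_powR.
  by apply: (measurableT_comp (measurable_powR _)); exact: measurableT_comp mv'.
- by move=> n r _; apply: sumr_ge0.
- by move=> r _; rewrite mulr_ge0 // powR_ge0.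
- move=> r e /=; rewrite in_itv /= andbT => r0 e0.
  have f0 n : 0 <= f n r by apply: sumr_ge0.
  (* A zero derivative, the default value included, asks only that the step functions be
     nonnegative. A nonzero one is a genuine derivative. *)
  have [v0|v0] := eqVneq (derive1 v r) 0.
    near=> n; rewrite v0 normr0 powR0 ?gt_eqF // mul0r sub0r.
    by rewrite (le_trans _ (f0 n)) // oppr_le0 ltW.
  have dv : derivable v r 1.
    apply: contrapT => ndv; move/eqP: v0; apply.
    apply: (@dvgP R (h^-1 *: (v (h + r) - v r) @[h --> 0^'])) => H; apply: ndv.
    rewrite /derivable /=.
    have -> : (fun h : R => h^-1 *: (v (h *: 1 + r) - v r)) =
      (fun h : R => h^-1 *: (v (h + r) - v r)).
      by apply/funext => h; rewrite [_%:A]mulr1.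
    exact: H.
  pose x n : R := (Num.trunc (r * n.+1%:R))%:R / n.+1%:R.
  pose y n : R := (Num.trunc (r * n.+1%:R)).+1%:R / n.+1%:R.
  have xry n : x n <= r < y n.
    rewrite ler_pdivrMr ?ltr0n // ltr_pdivlMr ?ltr0n //.
    by apply: truncn_itv; rewrite mulr_ge0 // ltW.
  have yx n : y n - x n = n.+1%:R^-1.
    by rewrite /x /y -mulrBl -natr1 addrAC subrr add0r mul1r.
  have d0 : (y n - x n) @[n --> \oo] --> (0 : R).
    by under eq_fun do rewrite yx; exact: cvg_harmonic.
  have := grid_slope_cvg p1 r0 dv xry d0 v0 => /cvgrPdist_le/(_ e e0) sl.
  near=> n.
  have n1 : r^-1 < n.+1%:R.
    apply: (@lt_trans _ _ n%:R); last by rewrite ltr_nat.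
    by near: n; exact: nbhs_infty_gtr.
  have n2 : r < n.+1%:R.
    apply: (@lt_trans _ _ n%:R); last by rewrite ltr_nat.
    by near: n; exact: nbhs_infty_gtr.
  have rn1 : 1 <= r * n.+1%:R by rewrite -ler_pdivrMl // mulr1 ltW.
  have rn0 : 0 <= r * n.+1%:R by rewrite (le_trans _ rn1).
  have k0 : (0 < Num.trunc (r * n.+1%:R))%N.
    by rewrite lt0n truncn_eq // negb_and -!leNgt -ltNge rn1 orbT.
  (* Because of the shift in [X], the index of the cell containing [r] is one below the
     truncation. *)
  have k1 : ((Num.trunc (r * n.+1%:R)).-1 < n.+1 * n.+1)%N.
    rewrite prednK // -ltnS truncn_lt_nat //.
    apply: (@lt_trans _ _ (n.+1 * n.+1)%:R); last by rewrite ltr_nat.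
    by rewrite natrM ltr_pM2r // ltr0n.
  have sln : grid_slope p v (x n) (y n) <= f n r.
    rewrite /f (bigD1 (Ordinal k1)) //=.
    have <- : X n (Ordinal k1) = x n by rewrite /X /x /= prednK.
    have <- : Y n (Ordinal k1) = y n by rewrite /Y /y /= prednK.
    rewrite indicE mem_set ?mulr1 ?lerDl ?sumr_ge0 //.
    by rewrite /= in_itv /= /X /Y /= prednK //; exact: xry.
  apply: le_trans sln; rewrite lerBlDr -lerBlDl.
  apply: le_trans (ler_norm _) _; near: n; exact: sl.
- move=> n.
  have -> : (\int[lebesgue_measure]_(x in `]0%R, +oo[) (f n x)%:E)%E =
    (\sum_i grid_slope p v (X n i) (Y n i) * (Y n i - X n i))%:E.
    rewrite /f; under eq_integral do rewrite -sumEFin.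
    rewrite ge0_integral_sum //; last 2 first.
    + by move=> i; apply/measurable_EFinP; exact: mterm.
    + by move=> i x _; rewrite lee_fin.
    rewrite -sumEFin; apply: eq_bigr => i _.
    under eq_integral do rewrite EFinM.
    rewrite ge0_integralZl_EFin //; first last.
    + by apply/measurable_EFinP; apply: measurable_funTS; exact: measurable_indic.
    rewrite integral_indic // setIidl; last first.
      by move=> x /=; rewrite !in_itv /= andbT => /andP[Xx _]; exact: lt_le_trans Xx.
    have mE : lebesgue_measure (`[X n i, Y n i[%classic : set R) = (Y n i - X n i)%:E.
      by rewrite lebesgue_measure_itv /= lte_fin XY EFinB.
    by rewrite [RHS]EFinM; congr (_ * _)%E; exact: mE.
  rewrite lee_fin.
  apply: le_trans (vC _ (X n) (Y n) _ _).
  + apply: ler_sum => i _; rewrite /grid_slope invfM mulrA divfK //.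
    by rewrite gt_eqF // subr_gt0.
  + by move=> i; rewrite X0 ltW.
  + apply/trivIset_oo => i j z; rewrite /X /Y => /andP[i1 i2] /andP[j1 j2].
    have := lt_trans i1 j2; have := lt_trans j1 i2.
    rewrite !ltr_pM2r ?invr_gt0 ?ltr0n // !ltr_nat !ltnS => ij ji.
    by apply/val_inj/anti_leq/andP; split.
Unshelve. all: by end_near. Qed.

(** * The tail of the exponential series *)

Definition exp_tail (R : realType) (N : nat) (t : R) : R :=
  expR t - \sum_(0 <= j < N) t ^+ j / j`!%:R.

Lemma exp_series_cvg (R : realType) (t : R) :
  (\sum_(0 <= j < n) t ^+ j / j`!%:R) @[n --> \oo] --> expR t.
Proof.
have := is_cvg_series_exp_coeff t.
rewrite /expR /series /=; exact.
Qed.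

Lemma sum_exp_coeff_le (R : realType) (t : R) (n : nat) : 0 <= t ->
  \sum_(0 <= j < n) t ^+ j / j`!%:R <= expR t.
Proof.
move=> t0; have cv := @exp_series_cvg R t.
rewrite -[leRHS](cvg_lim _ cv) //; apply: nondecreasing_cvgn_le; last first.
  by apply/cvg_ex; exists (expR t).
apply/nondecreasing_seqP => k; rewrite big_nat_recr //= lerDl.
by rewrite divr_ge0 // exprn_ge0.
Qed.

Lemma exp_tail_ge0 (R : realType) (N : nat) (t : R) : 0 <= t -> 0 <= exp_tail N t.
Proof. by move=> t0; rewrite subr_ge0 sum_exp_coeff_le. Qed.

(** Termwise, t^(N + j) / (N + j)! is at most t^N times t^j / j!. *)
Lemma exp_tail_le (R : realType) (N : nat) (t : R) : 0 <= t ->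
  exp_tail N t <= t ^+ N * expR t.
Proof.
move=> t0; rewrite lerBlDl.
apply: (@ler_cvg_to _ \oo _ _ (fun n => \sum_(0 <= j < n) t ^+ j / j`!%:R)
  (fun=> \sum_(0 <= j < N) t ^+ j / j`!%:R + t ^+ N * expR t)).
- exact: exp_series_cvg.
- exact: cvg_cst.
near=> n; have Nn : (N <= n)%N by near: n; exact: nbhs_infty_ge.
rewrite (big_cat_nat _ Nn) //= lerD2l.
apply: (@le_trans _ _ (t ^+ N * \sum_(0 <= j < n - N) t ^+ j / j`!%:R)); last first.
  by rewrite ler_wpM2l ?exprn_ge0 // sum_exp_coeff_le.
rewrite -{1}[N]add0n big_addn mulr_sumr; apply: ler_sum => j _.
rewrite addnC exprD -mulrA ler_wpM2l ?exprn_ge0 // ler_wpM2l ?exprn_ge0 //.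
rewrite lef_pV2 ?posrE ?ltr0n ?fact_gt0 // ler_nat.
by apply: leq_fact; exact: leq_addl.
Unshelve. all: by end_near. Qed.

Lemma exp_tail_continuous (R : realType) (N : nat) : continuous (@exp_tail R N).
Proof.
elim: N => [|N IH] t.
  rewrite (_ : exp_tail 0 = @expR R); first exact: continuous_expR.
  by apply/funext => x; rewrite /exp_tail big_nil subr0.
rewrite (_ : exp_tail N.+1 = fun x : R => exp_tail N x - x ^+ N / N`!%:R); last first.
  by apply/funext => x; rewrite /exp_tail big_nat_recr //= opprD addrA.
apply: cvgB; first exact: IH.
by apply: cvgM; [exact: exprn_continuous|exact: cvg_cst].
Qed.

(* The coefficient of t `^ (p - 1) is 1 / (p - 1)! when p is an integer and 0
   (an empty sum) otherwise; the remaining terms all have degree > p - 1. *)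
Lemma phi_split (R : realType) (p t : R) : 1 <= p -> 0 <= t ->
  phi p t = (\sum_(0 <= j < (Num.trunc (p - 1)).+1 | p - 1 <= j%:R) j`!%:R^-1) * t `^ (p - 1) +
    exp_tail (Num.trunc (p - 1)).+1 t.
Proof.
move=> p1 t0; set N := (Num.trunc _).+1.
have p10 : 0 <= p - 1 by rewrite subr_ge0.
have /andP[Np pN] := truncn_itv p10; rewrite -/N in pN.
rewrite /phi; apply/cvg_lim => //.
rewrite mulr_suml.
have -> : \sum_(0 <= j < N | p - 1 <= j%:R) j`!%:R^-1 * t `^ (p - 1) =
   \sum_(0 <= j < N | p - 1 <= j%:R) t ^+ j / j`!%:R.
  rewrite big_nat_cond [RHS]big_nat_cond; apply: eq_bigr => j /andP[/andP[_ jN] pj].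
  (* An index below [N] is at most the integer part of p - 1, so p - 1 <= j forces equality. *)
  have -> : p - 1 = j%:R.
    apply/le_anti; rewrite pj /=; apply: le_trans Np; by rewrite ler_nat -ltnS.
  by rewrite powR_mulrn // mulrC.
apply: cvg_trans (cvgD (cvg_cst _) (cvgB (@exp_series_cvg R t) (cvg_cst _))).
apply: near_eq_cvg; near=> n.
have Nn : (N <= n)%N by near: n; exact: nbhs_infty_ge.
rewrite !fctE /= [in LHS](big_cat_nat _ Nn) //= [RHS](big_cat_nat _ Nn) //= addrAC subrr add0r.
congr (_ + _); rewrite big_nat_cond [RHS]big_nat_cond; apply: eq_bigl => j.
case: (leqP N j) => //= Nj; rewrite andbT; case: ltnP => //= _.
by apply/esym/(le_trans (ltW pN)); rewrite ler_nat.
Unshelve. all: by end_near. Qed.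

(** * Power integrals, the Gamma function and dilations *)

(** Fatou's lemma for the truncations of [f]. It reduces improper integrals to intervals on which
    the fundamental theorem of calculus or a substitution applies. *)
Lemma integral_exhaust_le (R : realType) (D : set R) (E : nat -> set R) (f : R -> R) (C : \bar R) :
  measurable D -> (forall n, measurable (E n)) -> (forall n, E n `<=` D) ->
  (forall x, D x -> \forall n \near \oo, E n x) ->
  measurable_fun D f -> (forall x, D x -> 0 <= f x) ->
  (forall n, (\int[lebesgue_measure]_(x in E n) (f x)%:E <= C)%E) ->
  (\int[lebesgue_measure]_(x in D) (f x)%:E <= C)%E.
Proof.
move=> mD mE ED DE mf f0 fC.
have g0 n x : D x -> 0 <= f x * \1_(E n) x.
  by move=> Dx; rewrite mulr_ge0 ?f0 // indicE ler0n.
apply: (@fatou_le _ _ (fun n x => f x * \1_(E n) x)) => //.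
- by move=> n; apply: measurable_funM.
- move=> x e Dx e0; have := DE x Dx; apply: filterS => n Enx.
  by rewrite indicE mem_set // mulr1 gerBl ltW.
- move=> n; apply: le_trans (fC n).
  have mg : measurable_fun D (EFin \o (fun x => f x * \1_(E n) x)).
    by apply/measurable_EFinP; apply: measurable_funM.
  rewrite -(setDUK (ED n)) ge0_integral_setU //; first last.
  + by rewrite disj_set2E setDIK.
  + by move=> x; rewrite (setDUK (ED n)) => Dx; rewrite lee_fin g0.
  + by rewrite (setDUK (ED n)).
  + exact: (measurableD mD (mE n)).
  + exact: mE.
  rewrite [X in (_ + X)%E]integral0_eq ?adde0; last first.
    by move=> x [_ nE]; rewrite indicE memNset // mulr0.
  apply: ge0_le_integral => //.
  + exact: mE.
  + by move=> x Ex; rewrite lee_fin g0 //; exact: (ED n).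
  + exact: measurable_funS mg.
  + by apply/measurable_EFinP; exact: measurable_funS mf.
  + by move=> x Ex; rewrite indicE mem_set // mulr1.
Qed.

Lemma integral_powR_le (R : realType) (s M : R) : -1 < s -> 0 < M ->
  (\int[lebesgue_measure]_(x in `]0%R, M[) (x `^ s)%:E <= (M `^ (s + 1) / (s + 1))%:E)%E.
Proof.
move=> s1 M0; have s0 : 0 < s + 1 by lra.
apply: (@integral_exhaust_le _ _ (fun n => `]M / n.+2%:R, M[%classic)).
- exact: measurable_itv.
- by move=> n; exact: measurable_itv.
- move=> n x /=; rewrite !in_itv /= => /andP[nx ->]; rewrite andbT.
  by apply: lt_trans nx; rewrite divr_gt0.
- move=> x /=; rewrite in_itv /= => /andP[x0 xM].
  near=> n; rewrite in_itv /= xM andbT ltr_pdivrMr ?ltr0n // mulrC -ltr_pdivrMr //.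
  apply: (@lt_trans _ _ n%:R); last by rewrite ltr_nat.
  by near: n; exact: nbhs_infty_gtr.
- by apply: measurable_funTS; exact: measurable_powR.
- by move=> x _; exact: powR_ge0.
move=> n; have n0 : 0 < M / n.+2%:R by rewrite divr_gt0.
have dF (x : R) : 0 < x -> is_derive x 1 (fun x => x `^ (s + 1) / (s + 1)) (x `^ s).
  move=> x0.
  have := is_deriveM (is_derive1_powR (s + 1) x0) (is_derive_cst (s + 1)^-1 x 1).
  rewrite scaler0 add0r addrK => H.
  suff -> : x `^ s = (s + 1)^-1 * ((s + 1) * x `^ s) by exact: H.
  by rewrite mulrA mulVf ?mul1r // gt_eqF.
have cf (x : R) : 0 < x -> {for x, continuous (fun y : R => y `^ s)}.
  move=> x0; apply/differentiable_continuous/derivable1_diffP.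
  by case: (is_derive1_powR s x0).
have nM : M / n.+2%:R < M by rewrite ltr_pdivrMr ?ltr0n // ltr_pMr // ltr1n.
by rewrite (integral_FTC_pos dF cf n0 nM) lee_fin gerBl divr_ge0 ?powR_ge0 // ltW.
Unshelve. all: by end_near. Qed.

Lemma integral_powRN2_le (R : realType) :
  (\int[lebesgue_measure]_(x in `]1%R, +oo[) (x ^- 2)%:E <= (1 : R)%:E)%E.
Proof.
have cV (x : R) : 0 < x -> {for x, continuous (fun y : R => y ^- 2)}.
  move=> x0; apply: cvgV; first by rewrite gt_eqF // exprn_gt0.
  exact: exprn_continuous.
apply: (@integral_exhaust_le _ _ (fun n => `]1, n.+2%:R[%classic)).
- exact: measurable_itv.
- by move=> n; exact: measurable_itv.
- by move=> n x /=; rewrite !in_itv /= => /andP[->].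
- move=> x /=; rewrite in_itv /= andbT => x1.
  near=> n; rewrite in_itv /= x1 /=.
  apply: (@lt_trans _ _ n%:R); last by rewrite ltr_nat.
  by near: n; exact: nbhs_infty_gtr.
- apply: open_continuous_measurable_fun; first exact: interval_open.
  move=> x; rewrite inE /= in_itv /= andbT => x1; apply: cV; exact: lt_trans x1.
- by move=> x _; rewrite invr_ge0 exprn_even_ge0.
move=> n.
have dF (x : R) : 0 < x -> is_derive x 1 (fun x => - x^-1) (x ^- 2).
  move=> x0; have x_neq0 : x != 0 by rewrite gt_eqF.
  have := is_deriveN (is_deriveV x_neq0 (is_derive_id x 1)).
  rewrite scaleNr opprK [_ *: _]mulr1; exact.
have n1 : 1 < n.+2%:R :> R by rewrite ltr1n.
rewrite (integral_FTC_pos dF cV ltr01 n1).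
by rewrite lee_fin invr1 opprK gerDr oppr_le0 invr_ge0 ler0n.
Unshelve. all: by end_near. Qed.

(** [Gamma] is the real part [fine] of an integral, and [fine] sends +oo to 0; positivity therefore
    requires convergence as well. The integrand is compared with t^(x - 1) up to 1 and with a
    multiple of t^(-2) beyond. *)
Lemma Gamma_gt0 (R : realType) (x : R) : 0 < x -> 0 < Gamma x.
Proof.
move=> x0; rewrite /Gamma /Rintegral.
set g := fun t : R => t `^ (x - 1) * expR (- t).
have mexp : measurable_fun setT (fun t : R => expR (- t)).
  by apply: measurableT_comp => //; exact: measurableT_comp.
have mg : measurable_fun (setT : set R) g.
  by apply: measurable_funM => //; exact: measurable_powR.
have mg' (D : set R) : measurable_fun D (EFin \o g).
  by apply/measurable_EFinP; exact: measurable_funTS.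
have g0 t : 0 <= g t by rewrite mulr_ge0 ?powR_ge0 // expR_ge0.
have m (i : interval R) : measurable ([set` i] : set R) by exact: measurable_itv.
rewrite fine_gt0 //; apply/andP; split.
  apply: (@lt_le_trans _ _ (\int[lebesgue_measure]_(t in `]1%R, 2%R[) (2^-1 * expR (- 2))%R%:E)%E).
    rewrite integral_cst //= lebesgue_measure_itv /= lte_fin ltr1n -EFinB -EFinM lte_fin.
    by rewrite !mulr_gt0 ?expR_gt0 //; lra.
  apply: (@le_trans _ _ (\int[lebesgue_measure]_(t in `]1%R, 2%R[) (g t)%:E)%E).
    apply: ge0_le_integral => //.
    - exact: mg'.
    - move=> t /=; rewrite in_itv /= => /andP[t1 t2].
      rewrite lee_fin ler_pM ?expR_ge0 //; last by rewrite ler_expR; lra.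
      apply: (@le_trans _ _ (t `^ (-1))).
        by rewrite powR_inv1; [rewrite lef_pV2 ?posrE //; lra|lra].
      by apply: ler_powR; lra.
  apply: ge0_subset_integral => //;
    [exact: mg'|by move=> t _; rewrite lee_fin; exact: g0|].
  by move=> t /=; rewrite !in_itv /= andbT => /andP[t1 _]; exact: lt_trans t1.
have E : `]0, +oo[%classic = `]0, 1]%classic `|` `]1, +oo[%classic :> set R.
  by rewrite -itv_bndbnd_setU // bnd_simp.
rewrite E ge0_integral_setU //; first last.
- by apply/disj_set2P/seteqP; split => // t []; rewrite /= !in_itv /= andbT => /andP[_]; lra.
- by move=> t _; rewrite lee_fin; exact: g0.
- exact: mg'.
apply: lte_add_pinfty.
  rewrite integral_itv_bndoo //.
  apply: (@le_lt_trans _ _ (\int[lebesgue_measure]_(t in `]0%R, 1%R[) (t `^ (x - 1))%:E)%E).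
    apply: ge0_le_integral => //.
    - by move=> t _; rewrite lee_fin; exact: g0.
    - exact: mg'.
    - by apply/measurable_EFinP; apply: measurable_funTS; exact: measurable_powR.
    - move=> t /=; rewrite in_itv /= => /andP[t0 _]; rewrite lee_fin ler_piMr ?powR_ge0 //.
      by rewrite expR_le1 oppr_le0 ltW.
  by apply: (le_lt_trans (integral_powR_le _ _)) => //; [lra|exact: ltry].
(* An integer above x + 1, so that t^(x + 1) <= t^k <= k! e^t for t > 1. *)
pose k := Num.bound (x + 1).
have mV : measurable_fun (`]1, +oo[ : set R) (fun t : R => t ^- 2).
  apply: open_continuous_measurable_fun; first exact: interval_open.
  move=> t; rewrite inE /= in_itv /= andbT => t1.
  apply: cvgV; last exact: exprn_continuous.
  by rewrite gt_eqF // exprn_gt0 // (lt_trans _ t1).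
have K t : 1 < t -> g t <= k`!%:R * t ^- 2.
  move=> t1; have t0 : 0 < t by lra.
  have h : t `^ (x + 1) <= k`!%:R * expR t.
    apply: (@le_trans _ _ (t `^ k%:R)).
      by apply: ler_powR; [exact: ltW|apply/ltW/archi_boundP; lra].
    rewrite powR_mulrn ?(ltW t0) // mulrC -ler_pdivrMr ?ltr0n ?fact_gt0 //.
    apply: le_trans (sum_exp_coeff_le k.+1 (ltW t0)).
    rewrite big_nat_recr //= lerDr sumr_ge0 // => j _.
    by rewrite divr_ge0 // exprn_ge0 // ltW.
  have -> : g t = t `^ (x + 1) * expR (- t) * t ^- 2.
    have -> : t `^ (x + 1) = t `^ (x - 1) * t ^+ 2.
      rewrite -(powR_mulrn 2 (ltW t0)) -powRD; last by rewrite (gt_eqF t0) implybT.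
      by congr (_ `^ _); ring.
    by rewrite /g; field; rewrite gt_eqF.
  rewrite ler_pM2r ?invr_gt0 ?exprn_gt0 // expRN ler_pdivrMr //.
  exact: expR_gt0.
apply: (@le_lt_trans _ _ (\int[lebesgue_measure]_(t in `]1%R, +oo[) (k`!%:R%:E * (t ^- 2)%:E)%E)%E).
  apply: ge0_le_integral => //.
  - by move=> t _; rewrite lee_fin; exact: g0.
  - exact: mg'.
  - by apply/measurable_EFinP; apply: measurable_funM.
  - by move=> t /=; rewrite in_itv /= andbT => t1; rewrite -EFinM lee_fin; exact: K.
rewrite ge0_integralZl_EFin //.
- apply: (@le_lt_trans _ _ (k`!%:R%:E * 1%:E)%E); last by rewrite -EFinM ltry.
  by apply: lee_wpmul2l; [rewrite lee_fin|exact: integral_powRN2_le].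
- by move=> t _; rewrite lee_fin invr_ge0 exprn_even_ge0.
- exact/measurable_EFinP.
Qed.

Lemma omega_gt0 (R : realType) (t : R) : 0 <= t -> 0 < omega t.
Proof.
move=> t0; rewrite /omega divr_gt0 ?Gamma_gt0 //; last by lra.
by rewrite mulr_gt0 // powR_gt0 // pi_gt0.
Qed.

Lemma continuous_measurable_pos (R : realType) (h : R -> R) :
  (forall x : R, 0 < x -> {for x, continuous h}) ->
  measurable_fun (`]0, +oo[ : set R) h.
Proof.
move=> ch; apply: open_continuous_measurable_fun; first exact: interval_open.
by move=> x; rewrite inE /= in_itv /= andbT => x0; exact: ch.
Qed.

(** Substitution is carried out on the compact intervals [1 / (n + 2), n + 2], and the exhaustion
    gives one inequality. *)
Lemma integral_scale_le (R : realType) (h : R -> R) (l : R) : 0 < l ->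
  (forall x : R, 0 < x -> {for x, continuous h}) -> (forall x, 0 < x -> 0 <= h x) ->
  (\int[lebesgue_measure]_(x in `]0%R, +oo[) (h (l * x))%:E <=
   (l^-1)%:E * \int[lebesgue_measure]_(x in `]0%R, +oo[) (h x)%:E)%E.
Proof.
move=> l0 ch h0.
have m (i : interval R) : measurable ([set` i] : set R) by exact: measurable_itv.
have chl (x : R) : 0 < x -> {for x, continuous (fun y => h (l * y))}.
  move=> x0; apply: (@cvg_comp _ _ _ (fun y => l * y) h _ (nbhs (l * x))).
    by apply: cvgM; [exact: cvg_cst|exact: cvg_id].
  by apply: ch; rewrite mulr_gt0.
have mh := continuous_measurable_pos ch.
have mhl := continuous_measurable_pos chl.
apply: (@integral_exhaust_le _ _ (fun n => `[n.+2%:R^-1, n.+2%:R]%classic)) => //.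
- move=> n x /=; rewrite !in_itv /= andbT => /andP[nx _].
  by apply: lt_le_trans nx; rewrite invr_gt0 ltr0n.
- move=> x /=; rewrite in_itv /= andbT => x0.
  near=> n; rewrite in_itv /=; apply/andP; split.
    rewrite invf_ple ?posrE ?ltr0n //; apply/ltW.
    apply: (@lt_trans _ _ n%:R); last by rewrite ltr_nat.
    by near: n; exact: nbhs_infty_gtr.
  apply/ltW; apply: (@lt_trans _ _ n%:R); last by rewrite ltr_nat.
  by near: n; exact: nbhs_infty_gtr.
- by move=> x /=; rewrite in_itv /= andbT => x0; apply: h0; rewrite mulr_gt0.
move=> n; set a : R := n.+2%:R^-1; set b : R := n.+2%:R.
have a0 : 0 < a by rewrite invr_gt0 ltr0n.
have ab : a <= b.
  apply: (@le_trans _ _ 1); last by rewrite ler1n.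
  by rewrite invf_le1 ?ltr0n // ler1n.
have F' : derive1 (fun x : R => l * x) = cst l.
  apply/funext => x; rewrite derive1E.
  by rewrite (@derive_val _ _ _ _ _ _ _ (is_deriveZ l (is_derive_id x 1))) [_ *: _]mulr1.
have Fc (x : R) : (fun y : R => l * y) y @[y --> x] --> l * x.
  by apply: cvgM; [exact: cvg_cst|exact: cvg_id].
have S : (\int[lebesgue_measure]_(x in `[(l * a)%R, (l * b)%R]) (h x)%:E =
   \int[lebesgue_measure]_(x in `[a, b]) (((h \o (fun x => l * x)) * derive1 (fun x : R => l * x))%R x)%:E)%E.
  apply: (@integration_by_substitution_increasing R (fun x => l * x)) => //.
  - by move=> x y _ _ xy; rewrite ltr_pM2l.
  - by rewrite F' => x _; exact: cvg_cst.
  - by rewrite F'; exact: is_cvg_cst.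
  - by rewrite F'; exact: is_cvg_cst.
  - split.
    + by move=> x _; exact: ex_derive.
    + by apply: cvg_at_right_filter; exact: Fc.
    + by apply: cvg_at_left_filter; exact: Fc.
  - apply: continuous_in_subspaceT => x; rewrite inE /= in_itv /= => /andP[lx _].
    by apply: ch; apply: lt_le_trans lx; rewrite mulr_gt0.
have sub (c d : R) : 0 < c -> `[c, d]%classic `<=` `]0, +oo[%classic.
  by move=> c0 x /=; rewrite !in_itv /= andbT => /andP[cx _]; exact: lt_le_trans cx.
have -> : (\int[lebesgue_measure]_(x in `[a, b]) (h (l * x))%:E =
   (l^-1)%:E * \int[lebesgue_measure]_(x in `[(l * a)%R, (l * b)%R]) (h x)%:E)%E.
  rewrite S F' -ge0_integralZl_EFin //; last 3 first.
  - move=> x /(sub _ _ a0) /=; rewrite in_itv /= andbT => x0; rewrite lee_fin mulr_ge0 //.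
      by rewrite h0 // mulr_gt0.
    exact: ltW.
  - apply/measurable_EFinP; apply: measurable_funM => //.
    by apply: measurable_funS mhl => //; exact: sub.
  - by rewrite invr_ge0 ltW.
  apply: eq_integral => x _; rewrite -EFinM; congr (_%:E).
  by rewrite !fctE /=; field; rewrite gt_eqF.
apply: lee_wpmul2l; first by rewrite lee_fin invr_ge0 ltW.
have la0 : 0 < l * a by rewrite mulr_gt0.
apply: ge0_subset_integral => //.
- exact/measurable_EFinP.
- by move=> x /=; rewrite in_itv /= andbT lee_fin; exact: h0.
- exact: sub.
Unshelve. all: by end_near. Qed.

(** The reverse inequality is the same one for the dilated function and the factor l^(-1). *)
Lemma integral_scale (R : realType) (h : R -> R) (l : R) : 0 < l ->
  (forall x : R, 0 < x -> {for x, continuous h}) -> (forall x, 0 < x -> 0 <= h x) ->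
  (\int[lebesgue_measure]_(x in `]0%R, +oo[) (h (l * x))%:E =
   (l^-1)%:E * \int[lebesgue_measure]_(x in `]0%R, +oo[) (h x)%:E)%E.
Proof.
move=> l0 ch h0; apply/eqP; rewrite eq_le integral_scale_le //=.
have chl (x : R) : 0 < x -> {for x, continuous (fun y => h (l * y))}.
  move=> x0; apply: (@cvg_comp _ _ _ (fun y => l * y) h _ (nbhs (l * x))).
    by apply: cvgM; [exact: cvg_cst|exact: cvg_id].
  by apply: ch; rewrite mulr_gt0.
have hl0 x : 0 < x -> 0 <= h (l * x) by move=> x0; rewrite h0 // mulr_gt0.
have l10 : 0 < l^-1 by rewrite invr_gt0.
have := integral_scale_le l10 chl hl0; rewrite invrK.
under eq_integral do rewrite mulrA divff ?gt_eqF // mul1r.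
move=> H; apply: (@le_trans _ _ ((l^-1)%:E * (l%:E *
    \int[lebesgue_measure]_(x in `]0%R, +oo[) (h (l * x))%:E))%E).
  by apply: lee_wpmul2l => //; rewrite lee_fin ltW.
by rewrite muleA -EFinM mulVf ?gt_eqF // mul1e.
Qed.

(** * Compactness *)

(** If g exceeded 2 K / (b - a) throughout ]a, b[, its integral would be at least 2 K > K. The
    factor 2 lets weak inequalities between integrals yield the contradiction. *)
Lemma integral_pigeonhole (R : realType) (g : R -> R) (K a b : R) : 0 < a -> a < b -> 0 < K ->
  measurable_fun (`]0, +oo[ : set R) g -> (forall r, 0 < r -> 0 <= g r) ->
  (\int[lebesgue_measure]_(r in `]0%R, +oo[) (g r)%:E <= K%:E)%E ->
  exists s, [/\ a < s, s < b & g s * (b - a) <= 2 * K].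
Proof.
move=> a0 ab K0 mg g0 gK; apply: contrapT => H.
have m (i : interval R) : measurable ([set` i] : set R) by exact: measurable_itv.
have big s : a < s -> s < b -> 2 * K / (b - a) <= g s.
  move=> sa sb; rewrite ler_pdivrMr ?subr_gt0 //; apply/ltW; rewrite ltNge.
  by apply/negP => h; apply: H; exists s.
have : (\int[lebesgue_measure]_(r in `]a, b[) (2 * K / (b - a))%:E <= K%:E)%E.
  apply: le_trans gK.
  have sub : `]a, b[%classic `<=` `]0, +oo[%classic.
    by move=> x /=; rewrite !in_itv /= andbT => /andP[ax _]; exact: lt_trans ax.
  apply: (@le_trans _ _ (\int[lebesgue_measure]_(r in `]a, b[) (g r)%:E)%E).
    apply: ge0_le_integral => //.
    - move=> x _; rewrite lee_fin divr_ge0 ?mulr_ge0 ?(ltW K0) //.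
      by rewrite subr_ge0 ltW.
    - by apply/measurable_EFinP; apply: measurable_funS mg.
    - by move=> x /=; rewrite in_itv /= => /andP[? ?]; rewrite lee_fin big.
  apply: ge0_subset_integral => //; first exact/measurable_EFinP.
  by move=> x /=; rewrite in_itv /= andbT lee_fin; exact: g0.
rewrite integral_cst //= lebesgue_measure_itv /= lte_fin ab -EFinB -EFinM lee_fin.
by rewrite divfK ?gt_eqF ?subr_gt0 //; lra.
Qed.

(* Two facts about v are used: the modulus of continuity in ln r, and the fact
   that |v| has to be small somewhere in [r, (1 + d) r]. *)
Lemma uniform_decay (R : realType) (p C K th e : R) :
  1 < p -> 0 < C -> 0 < K -> 0 <= th -> 0 < e ->
  exists2 M, 1 <= M & forall v, log_energy_le p C v ->
    (\int[lebesgue_measure]_(r in `]0%R, +oo[) (`|v r| `^ p * r `^ th)%:E <= K%:E)%E ->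
    forall r, M <= r -> `|v r| <= e.
Proof.
move=> p1 C0 K0 th0 e0.
have p0 : 0 < p by lra.
have q0 : 0 < (p - 1) / p by rewrite divr_gt0 //; lra.
have e20 : 0 < e / 2 by rewrite divr_gt0.
have Cp0 : 0 < C `^ p^-1 by exact: powR_gt0.
(* So small that [v] varies by at most e / 2 over [r, (1 + d) r], where ln s - ln r <= d. *)
pose d := Num.min 1 ((e / 2 / C `^ p^-1) `^ ((p - 1) / p)^-1).
have d0 : 0 < d by rewrite lt_min ltr01 powR_gt0 // divr_gt0.
have d1 : d <= 1 by rewrite ge_min lexx.
have dC : C `^ p^-1 * d `^ ((p - 1) / p) <= e / 2.
  rewrite mulrC -ler_pdivlMr //.
  have h : d <= (e / 2 / C `^ p^-1) `^ ((p - 1) / p)^-1 by rewrite ge_min lexx orbT.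
  apply: (le_trans (ge0_ler_powR (ltW q0) _ _ h)); rewrite ?nnegrE ?powR_ge0 ?(ltW d0) //.
  by rewrite -powRrM mulVf ?gt_eqF // powRr1 // divr_ge0 // ltW.
(* For r >= M the product d r (e / 2)^p is at least 2 K, so the pigeonhole point [s] cannot have |v
   s| > e / 2; the bound M >= 1 ensures s^th >= 1. *)
pose M := Num.max 1 (2 * K / (d * (e / 2) `^ p)).
exists M; first by rewrite le_max lexx.
move=> v vC vK r Mr.
have r1 : 1 <= r by apply: le_trans Mr; rewrite le_max lexx.
have r0 : 0 < r by lra.
have rb : r < (1 + d) * r by rewrite ltr_pMl //; lra.
have cv (x : R) : 0 < x -> {for x, continuous v}.
  by move=> x0; exact: (log_energy_continuous p1 (ltW C0) vC x0).
have mv : measurable_fun (`]0, +oo[ : set R) (fun r => `|v r| `^ p * r `^ th).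
  apply: measurable_funM; last by apply: measurable_funTS; exact: measurable_powR.
  apply: (measurableT_comp (measurable_powR _)).
  by apply: measurableT_comp => //; exact: continuous_measurable_pos.
have g0 s : 0 < s -> 0 <= `|v s| `^ p * s `^ th by move=> _; rewrite mulr_ge0 // powR_ge0.
have [s [rs sb vs]] := integral_pigeonhole r0 rb K0 mv g0 vK.
have small : `|v s| <= e / 2.
  rewrite leNgt; apply/negP => h.
  have hp : (e / 2) `^ p < `|v s| `^ p.
    by rewrite gt0_ltr_powR // ?nnegrE ?normr_ge0 // ltW.
  have s1 : 1 <= s `^ th.
    have := @ge0_ler_powR R th th0 1 s; rewrite !nnegrE powR1; apply; lra.
  have Mr' : 2 * K <= r * (d * (e / 2) `^ p).
    rewrite -ler_pdivrMr ?mulr_gt0 ?powR_gt0 //.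
    by apply: le_trans Mr; rewrite le_max lexx orbT.
  have : (e / 2) `^ p * (d * r) < `|v s| `^ p * s `^ th * ((1 + d) * r - r).
    rewrite (_ : (1 + d) * r - r = d * r); last by ring.
    rewrite ltr_pM2r ?mulr_gt0 //; apply: (lt_le_trans hp).
    by rewrite ler_peMr // powR_ge0.
  by rewrite ltNge => /negP; apply; apply: le_trans vs _; move: Mr'; congr (_ <= _); ring.
have := log_energy_modulus p1 (ltW C0) vC r0 (ltW rs).
have lnsr : ln s - ln r <= d.
  apply: (le_trans (ler_lnB r0 (lexx r) (ltW rs))).
  by rewrite ler_pdivrMr //; lra.
have lnsr0 : 0 <= ln s - ln r by rewrite subr_ge0 ler_ln ?posrE //; lra.
have : C `^ p^-1 * (ln s - ln r) `^ ((p - 1) / p) <= e / 2.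
  apply: le_trans dC; rewrite ler_wpM2l ?(ltW Cp0) // ge0_ler_powR ?nnegrE ?(ltW q0) //.
  exact: ltW.
move=> h1 h2; have := le_trans h2 h1.
have := ler_distD (v s) (v r) 0; rewrite !subr0 (distrC (v r)).
by move: small; lra.
Qed.

(** Either a <= eta b or b < a / eta, and each case gives one of the two terms. The coefficient of
    b^q can be brought as close to 1 as desired, at the expense of that of a^q. *)
Lemma powR_add_le (R : realType) (q a b eta : R) : 0 <= q -> 0 <= a -> 0 <= b -> 0 < eta ->
  (a + b) `^ q <= (1 + eta) `^ q * b `^ q + (1 + eta^-1) `^ q * a `^ q.
Proof.
move=> q0 a0 b0 eta0.
have [ab|ba] := leP a (eta * b).
  apply: (@le_trans _ _ (((1 + eta) * b) `^ q)).
    by rewrite ge0_ler_powR ?nnegrE //; nra.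
  rewrite powRM //; last by lra.
  by rewrite lerDl mulr_ge0 // powR_ge0.
have ei0 : 0 < eta^-1 by rewrite invr_gt0.
apply: (@le_trans _ _ (((1 + eta^-1) * a) `^ q)).
  have : b <= eta^-1 * a by rewrite ler_pdivlMl // ltW.
  by move=> h; rewrite ge0_ler_powR ?nnegrE //; nra.
rewrite powRM //; last by lra.
by rewrite lerDr mulr_ge0 // powR_ge0.
Qed.

(** For eta <= 1 and q <= 2 the factor (1 + eta)^q is at most (1 + eta)^2 <= 1 + 3 eta, and 3 eta X
    stays below c - X by the choice of [eta]. *)
Lemma exists_subcritical (R : realType) (X c q : R) : 0 <= X -> X < c -> 0 <= q -> q <= 2 ->
  exists2 eta, 0 < eta & X * (1 + eta) `^ q < c.
Proof.
move=> X0 Xc q0 q2.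
pose eta := Num.min 1 ((c - X) / (4 * (X + 1))).
have X4 : 0 < 4 * (X + 1) by lra.
have eta0 : 0 < eta by rewrite lt_min ltr01 divr_gt0 // subr_gt0.
have eta1 : eta <= 1 by rewrite ge_min lexx.
have etaX : eta * (4 * (X + 1)) <= c - X.
  by rewrite -ler_pdivlMr // ge_min lexx orbT.
exists eta => //.
have : (1 + eta) `^ q <= (1 + eta) ^+ 2.
  by rewrite -powR_mulrn; [apply: ler_powR; lra|lra].
by rewrite expr2 => h; nra.
Qed.

(** The power q = p / (p - 1) cancels the exponent (p - 1) / p of the modulus, leaving a multiple of
    ln (M / r); its exponential is a power of M / r. The value at [M] contributes only a constant
    factor. *)
Lemma expR_growth (R : realType) (p C mu eta e M r : R) (v : R -> R) :
  1 < p -> 0 < C -> 0 <= mu -> 0 < eta -> 0 <= e -> log_energy_le p C v ->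
  0 < r -> r <= M -> `|v M| <= e ->
  expR (mu * `|v r| `^ (p / (p - 1))) <=
  expR (mu * ((1 + eta^-1) `^ (p / (p - 1)) * e `^ (p / (p - 1)))) *
    (M / r) `^ (mu * (1 + eta) `^ (p / (p - 1)) * C `^ (p - 1)^-1).
Proof.
move=> p1 C0 mu0 eta0 e0 vC r0 rM vM.
have p0 : 0 < p by lra.
have p10 : 0 < p - 1 by lra.
set q := p / (p - 1); have q0 : 0 < q by rewrite divr_gt0.
have M0 : 0 < M by exact: lt_le_trans rM.
have MrE : ln (M / r) = ln M - ln r by rewrite ln_div ?posrE.
have L0 : 0 <= ln M - ln r by rewrite subr_ge0 ler_ln.
have powE G : (M / r) `^ G = expR (G * (ln M - ln r)).
  by rewrite /powR gt_eqF ?divr_gt0 // MrE.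
rewrite powE -expRD ler_expR.
set b := C `^ p^-1 * (ln M - ln r) `^ ((p - 1) / p).
have b0 : 0 <= b by rewrite mulr_ge0 // powR_ge0.
have vr : `|v r| <= e + b.
  have := log_energy_modulus p1 (ltW C0) vC r0 rM; rewrite -/b.
  have := ler_distD (v M) (v r) 0; rewrite !subr0 (distrC (v r)).
  by move: vM; lra.
have bq : b `^ q = C `^ (p - 1)^-1 * (ln M - ln r).
  rewrite powRM ?powR_ge0 // -!powRrM.
  have -> : p^-1 * q = (p - 1)^-1 by rewrite /q; field; rewrite !gt_eqF.
  have -> : (p - 1) / p * q = 1 by rewrite /q; field; rewrite !gt_eqF.
  by rewrite powRr1.
have := powR_add_le (ltW q0) e0 b0 eta0; rewrite bq => h.
have vrq : `|v r| `^ q <= (e + b) `^ q.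
  by rewrite ge0_ler_powR ?nnegrE ?(ltW q0) // addr_ge0.
have := ler_wpM2l mu0 (le_trans vrq h).
move=> /le_trans; apply; rewrite mulrDr addrC lerD2l.
by rewrite le_eqVlt; apply/orP; left; apply/eqP; ring.
Qed.

(* Tychonoff's theorem on the product of the segments [- B r, B r]. *)
Lemma pointwise_cluster (R : realType) (B : R -> R) (w : nat -> R -> R) :
  (forall n r, `|w n r| <= B r) ->
  exists v : R -> R, forall (s : seq R) (e : R) (N : nat), 0 < e ->
    exists2 n, (N <= n)%N & all (fun r => `|v r - w n r| < e) s.
Proof.
move=> wB; pose A (r : R) : set R := `[- B r, B r]%classic.
have cA r : compact (A r) by exact: segment_compact.
pose F : set_system (forall r : R, R) := (w n : forall r : R, R) @[n --> \oo].
have FF : ProperFilter F by exact: fmap_proper_filter.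
have [|v [_ vcl]] := tychonoff cA FF.
  by exists 0%N => // n _ r; rewrite /A /= in_itv /= -ler_norml.
exists v => s e N e0.
have nv : nbhs v [set f : forall r : R, R | all (fun r => `|v r - f r| < e) s].
  elim: s => [|r s IH] /=; first exact: filterE.
  have : nbhs v (@proj R (fun=> R) r @^-1` [set z | `|v r - z| < e]).
    by apply: proj_continuous; apply/nbhs_ballP; exists e.
  move: IH; apply: filterS2 => f sf rf.
  by apply/andP; split.
have FN : F [set f | exists2 n, (N <= n)%N & f = w n].
  by exists N => // n /= Nn; exists n.
by have [f [[n Nn ->] sf]] := vcl _ _ FN nv; exists n.
Qed.

Lemma log_modulus_small (R : realType) (p C e r : R) : 1 < p -> 0 < C -> 0 < e -> 0 < r ->
  exists2 d, 0 < d & forall x, r <= x -> x < r + d ->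
    C `^ p^-1 * (ln x - ln r) `^ ((p - 1) / p) <= e.
Proof.
move=> p1 C0 e0 r0.
have q0 : 0 < (p - 1) / p by rewrite divr_gt0; lra.
have Cp0 : 0 < C `^ p^-1 by exact: powR_gt0.
have eC0 : 0 < e / C `^ p^-1 by rewrite divr_gt0.
exists ((e / C `^ p^-1) `^ ((p - 1) / p)^-1 * r); first by rewrite mulr_gt0 // powR_gt0.
move=> x rx xr; rewrite mulrC -ler_pdivlMr //.
have l0 : 0 <= ln x - ln r by rewrite subr_ge0 ler_ln ?posrE // (lt_le_trans r0).
have h : ln x - ln r <= (e / C `^ p^-1) `^ ((p - 1) / p)^-1.
  apply: (le_trans (ler_lnB r0 (lexx r) rx)).
  by rewrite ler_pdivrMr // lerBlDl ltW.
apply: (le_trans (ge0_ler_powR (ltW q0) _ _ h)); rewrite ?nnegrE ?powR_ge0 //.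
by rewrite -powRrM mulVf ?gt_eqF // powRr1 // ltW.
Qed.

(** A cluster point of an uncountable product need not be the limit of a subsequence. So [k n] is
    chosen to approximate [v] within 1 / (n + 1) at the first n terms of an enumeration of the
    rationals, and the common modulus of continuity carries the convergence over to every r > 0. *)
Lemma pointwise_extraction (R : realType) (p C : R) (B : R -> R) (u : nat -> R -> R) :
  1 < p -> 0 < C -> (forall n, log_energy_le p C (u n)) ->
  (forall n r, 0 < r -> `|u n r| <= B r) ->
  exists (v : R -> R) (k : nat -> nat), (forall n, (n <= k n)%N) /\
    forall r, 0 < r -> u (k n) r @[n --> \oo] --> v r.
Proof.
move=> p1 C0 uC uB.
pose w n r := if 0 < r then u n r else 0.
have wB n r : `|w n r| <= `|B r|.
  rewrite /w; case: ifPn => [r0|_]; last by rewrite normr0.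
  exact: le_trans (uB n r r0) (ler_norm _).
have [v vw] := pointwise_cluster wB.
pose q (i : nat) : R := ratr (odflt 0%Q (unpickle i)).
have ch (n : nat) : exists m, (n <= m)%N /\
    all (fun r => `|v r - w m r| < n.+1%:R^-1) (map q (iota 0 n)).
  by have [m nm vm] := vw (map q (iota 0 n)) _ n (invn_gt0 R n); exists m.
have [k kP] := choice ch.
exists v, k; split => [n|r r0]; first by case: (kP n).
apply/cvgrPdist_le => e e0.
have e40 : 0 < e / 4 by rewrite divr_gt0.
have [d d0 dmod] := log_modulus_small p1 C0 e40 r0.
have [z [zI [a _ aE]]] : exists x, (`]r, (r + d)[%classic `&` range (@ratr R)) x.
  apply: dense_rat; last exact: interval_open.
  by exists (r + d / 2); rewrite /= in_itv /=; apply/andP; split; lra.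
move: zI; rewrite -aE /= in_itv /= => /andP[ra ad] {aE z}.
have umod n : `|u n (ratr a) - u n r| <= e / 4.
  apply: le_trans (dmod _ (ltW ra) ad).
  exact: (log_energy_modulus p1 (ltW C0) (uC n) r0 (ltW ra)).
have a0 : 0 < ratr a :> R by exact: lt_trans ra.
have vmod : `|v (ratr a) - v r| <= e / 4.
  (* The cluster property at [r] and [ratr a] simultaneously hands the modulus of the sequence on to
     [v]. *)
  apply/ler_addgt0Pr => eta eta0.
  have eta20 : 0 < eta / 2 by rewrite divr_gt0.
  have [n _ /= /and3P[h1 h2 _]] := vw [:: r; ratr a] _ 0%N eta20.
  move: h1 h2; rewrite /w r0 a0 !ltr_norml => /andP[? ?] /andP[? ?].
  have := umod n; rewrite !ler_norml => /andP[? ?].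
  by apply/andP; split; lra.
near=> n.
have an : (pickle a < n)%N by near: n; exact: nbhs_infty_gt.
have [_ /allP/(_ (ratr a))] := kP n.
have -> : ratr a \in map q (iota 0 n).
  apply/mapP; exists (pickle a); first by rewrite mem_iota.
  by rewrite /q pickleK.
move=> /(_ isT); rewrite /w a0 => va.
have {}va : `|v (ratr a) - u (k n) (ratr a)| < e / 4.
  apply: lt_trans va _.
  rewrite invf_plt ?posrE ?ltr0n //; apply: (@lt_trans _ _ n%:R); last by rewrite ltr_nat.
  by near: n; exact: nbhs_infty_gtr.
move: va; rewrite ltr_norml => /andP[? ?].
have := umod (k n); have := vmod; rewrite !ler_norml => /andP[? ?] /andP[? ?].
by apply/andP; split; lra.
Unshelve. all: by end_near. Qed.

Lemma log_energy_closed (R : realType) (p C : R) (u : nat -> R -> R) (v : R -> R) :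
  1 < p -> (forall n, log_energy_le p C (u n)) ->
  (forall r, 0 < r -> u n r @[n --> \oo] --> v r) -> log_energy_le p C v.
Proof.
move=> p1 uC uv T x y xy tI; have p0 : 0 < p by lra.
apply/ler_addgt0Pr => e e0.
pose F (w : R -> R) i := `|w (y i) - w (x i)| `^ p / (ln (y i) - ln (x i)) `^ (p - 1).
have F0 w i : 0 <= F w i by rewrite divr_ge0 ?powR_ge0.
have e'0 : 0 < e / #|T|.+1%:R by rewrite divr_gt0 // ltr0n.
have near1 i : \forall n \near \oo, F v i <= F (u n) i + e / #|T|.+1%:R.
  have /andP[x0 xyi] := xy i.
  (* Terms with limit 0 are set apart because [powR_cvg] asks for a positive limit; nonnegativity of
     the approximating terms settles them. *)
  have [d0|d0] := eqVneq (v (y i) - v (x i)) 0.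
    apply: nearW => n; rewrite {1}/F d0 normr0 powR0 ?gt_eqF // mul0r.
    by rewrite addr_ge0 // ltW.
  have : F (u n) i @[n --> \oo] --> F v i.
    apply: cvgM; last exact: cvg_cst.
    apply: powR_cvg; first by rewrite normr_gt0.
    by apply: cvg_norm; apply: cvgB; apply: uv => //; exact: lt_le_trans xyi.
  move=> /cvgrPdist_le/(_ _ e'0); apply: filterS => n.
  by rewrite ler_norml => /andP[_ h]; rewrite addrC -lerBlDr.
have : \forall n \near \oo, forall i, F v i <= F (u n) i + e / #|T|.+1%:R.
  exact: filter_forall.
move=> [n _ /(_ n (leqnn n)) Hn].
apply: (@le_trans _ _ (\sum_i (F (u n) i + e / #|T|.+1%:R))).
  by apply: ler_sum => i _; exact: Hn.
rewrite big_split /= lerD //; first exact: uC.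
rewrite sumr_const -[leLHS]mulr_natl mulrCA ger_pMr // ler_pdivrMr ?ltr0n // mul1r ler_nat.
by rewrite leqnSn.
Qed.

Lemma continuous_powR_pos (R : realType) (s x : R) : 0 < x ->
  {for x, continuous (fun y : R => y `^ s)}.
Proof.
move=> x0; apply/differentiable_continuous/derivable1_diffP.
by case: (is_derive1_powR s x0).
Qed.

Lemma continuous_normr_powR (R : realType) (q : R) : 0 < q ->
  continuous (fun x : R => `|x| `^ q).
Proof.
move=> q0 x; have [->|x0] := eqVneq x 0.
  apply/cvgrPdist_lt => e e0.
  have d0 : 0 < e `^ q^-1 by exact: powR_gt0.
  near=> y; rewrite normr0 powR0 ?gt_eqF // sub0r normrN ger0_norm ?powR_ge0 //.
  have yd : `|y| < e `^ q^-1.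
    by rewrite -normrN -sub0r; near: y; exact: cvgr_dist_lt.
  have := gt0_ltr_powR q0 (_ : `|y| \in Num.nneg) (_ : e `^ q^-1 \in Num.nneg) yd.
  by rewrite !nnegrE powR_ge0 normr_ge0 -powRrM mulVf ?gt_eqF // powRr1 ?(ltW e0) //; apply.
apply: (@cvg_comp _ _ _ (fun x : R => `|x|) (fun x => x `^ q) _ (nbhs `|x|)).
  exact: norm_continuous.
by apply: continuous_powR_pos; rewrite normr_gt0.
Unshelve. all: by end_near. Qed.

(** * The integral of psi over an energy ball *)

Section exponential_functional.
Context {R : realType}.
Variables (p C K th mu : R) (N : nat).
Hypotheses (p2 : 2 <= p) (C0 : 0 < C) (K0 : 0 < K) (th0 : 0 <= th) (mu0 : 0 <= mu).
Hypotheses (mulC : mu * C `^ (p - 1)^-1 < th + 1) (pN : p - 1 < N%:R).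

Let q := p / (p - 1).
Let psi (a : R) := exp_tail N (mu * `|a| `^ q).

Let p0 : 0 < p. Proof. by move: p2; lra. Qed.
Let p10 : 0 < p - 1. Proof. by move: p2; lra. Qed.
Let p1 : 1 < p. Proof. by move: p2; lra. Qed.
Let q0 : 0 < q. Proof. by rewrite divr_gt0. Qed.
Let q2 : q <= 2. Proof. by rewrite ler_pdivrMr //; move: p2; lra. Qed.

Definition energy_ball (v : R -> R) : Prop := log_energy_le p C v /\
  (\int[lebesgue_measure]_(r in `]0%R, +oo[) (`|v r| `^ p * r `^ th)%:E <= K%:E)%E.

Lemma psi_continuous : continuous psi.
Proof.
move=> a; rewrite /psi.
apply: (@cvg_comp _ _ _ (fun a => mu * `|a| `^ q) (@exp_tail R N) _ (nbhs (mu * `|a| `^ q))).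
  by apply: cvgM; [exact: cvg_cst|exact: continuous_normr_powR].
exact: exp_tail_continuous.
Qed.

Lemma psi_ge0 a : 0 <= psi a.
Proof. by apply: exp_tail_ge0; rewrite mulr_ge0 // powR_ge0. Qed.

Lemma psi_le_exp a : psi a <= expR (mu * `|a| `^ q).
Proof.
rewrite gerBl; apply: sumr_ge0 => j _.
by rewrite divr_ge0 // exprn_ge0 // mulr_ge0 // powR_ge0.
Qed.

(** By [pN] the lowest power |a|^(q N) has q N > p, which leaves a positive power of |a| beside
    |a|^p. The resulting factor e^(q N - p) is what makes tails uniformly small. *)
Lemma psi_le_small e a : `|a| <= e -> e <= 1 ->
  psi a <= mu ^+ N * expR mu * e `^ (q * N%:R - p) * `|a| `^ p.
Proof.
move=> ae e1; have e0 : 0 <= e by exact: le_trans ae.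
have kap0 : 0 < q * N%:R - p.
  rewrite subr_gt0 /q mulrAC ltr_pdivlMr // ltr_pM2l //.
have [a0|a0] := eqVneq a 0.
  rewrite a0 /psi normr0 powR0 ?gt_eqF // mulr0 powR0 ?gt_eqF // mulr0.
  rewrite (le_trans (exp_tail_le _ _)) // expr0n.
  case: N pN => [|n _]; last by rewrite mul0r.
  by move: p10; lra.
have na0 : 0 < `|a| by rewrite normr_gt0.
have aq1 : `|a| `^ q <= 1.
  by have := @ge0_ler_powR R q (ltW q0) `|a| 1; rewrite !nnegrE powR1; apply; lra.
have muaq0 : 0 <= mu * `|a| `^ q by rewrite mulr_ge0 // powR_ge0.
apply: (le_trans (exp_tail_le _ muaq0)).
rewrite exprMn -(powR_mulrn N (powR_ge0 `|a| q)) -powRrM.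
have -> : `|a| `^ (q * N%:R) = `|a| `^ (q * N%:R - p) * `|a| `^ p.
  by rewrite -powRD ?subrK // (gt_eqF na0) implybT.
have h1 : `|a| `^ (q * N%:R - p) <= e `^ (q * N%:R - p).
  by rewrite ge0_ler_powR ?nnegrE ?(ltW kap0).
have h2 : expR (mu * `|a| `^ q) <= expR mu by rewrite ler_expR ler_piMr.
rewrite (_ : mu ^+ N * (`|a| `^ (q * N%:R - p) * `|a| `^ p) * expR (mu * `|a| `^ q) =
  (mu ^+ N * `|a| `^ p) * (`|a| `^ (q * N%:R - p) * expR (mu * `|a| `^ q))); last by ring.
rewrite (_ : mu ^+ N * expR mu * e `^ (q * N%:R - p) * `|a| `^ p =
  (mu ^+ N * `|a| `^ p) * (e `^ (q * N%:R - p) * expR mu)); last by ring.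
apply: ler_wpM2l; first by rewrite mulr_ge0 ?exprn_ge0 ?powR_ge0.
by apply: ler_pM; rewrite ?powR_ge0 ?expR_ge0.
Qed.

Lemma measurable_psi v : (forall x : R, 0 < x -> {for x, continuous v}) ->
  measurable_fun (`]0, +oo[ : set R) (fun r => psi (v r) * r `^ th).
Proof.
move=> cv; apply: continuous_measurable_pos => x x0.
apply: cvgM; last exact: continuous_powR_pos.
apply: (@cvg_comp _ _ _ v psi _ (nbhs (v x))); first exact: cv.
exact: psi_continuous.
Qed.

Lemma energy_ball_continuous v : energy_ball v -> forall x : R, 0 < x -> {for x, continuous v}.
Proof. by move=> [vC _] x x0; exact: (log_energy_continuous p1 (ltW C0) vC x0). Qed.

Lemma tail_le v e M : energy_ball v -> 0 < M -> e <= 1 -> (forall r, M <= r -> `|v r| <= e) ->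
  (\int[lebesgue_measure]_(r in `[M, +oo[) (psi (v r) * r `^ th)%:E <=
   (mu ^+ N * expR mu * e `^ (q * N%:R - p) * K)%:E)%E.
Proof.
move=> vB M0 e1 ve; have [_ vK] := vB.
have cv := energy_ball_continuous vB.
set A := mu ^+ N * expR mu * _.
have A0 : 0 <= A by rewrite !mulr_ge0 ?exprn_ge0 ?expR_ge0 ?powR_ge0.
have sub : `[M, +oo[%classic `<=` (`]0, +oo[%classic : set R).
  by move=> x /=; rewrite !in_itv /= !andbT; exact: lt_le_trans.
have mp : measurable_fun (`]0, +oo[ : set R) (fun r => `|v r| `^ p * r `^ th).
  apply: continuous_measurable_pos => x x0.
  apply: cvgM; last exact: continuous_powR_pos.
  apply: (@cvg_comp _ _ _ v (fun a : R => `|a| `^ p) _ (nbhs (v x))); first exact: cv.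
  exact: (continuous_normr_powR p0).
have pth0 r : 0 <= `|v r| `^ p * r `^ th by rewrite mulr_ge0 // powR_ge0.
apply: (@le_trans _ _ (A%:E * \int[lebesgue_measure]_(r in `[M, +oo[) (`|v r| `^ p * r `^ th)%:E)%E).
  rewrite -ge0_integralZl_EFin //; first last.
  - by apply/measurable_EFinP; apply: measurable_funS mp.
  - by move=> r _; rewrite lee_fin; exact: pth0.
  apply: ge0_le_integral => //.
  - by move=> r _; rewrite lee_fin mulr_ge0 ?psi_ge0 ?powR_ge0.
  - by apply/measurable_EFinP; apply: measurable_funS (measurable_psi cv).
  - by apply/measurable_EFinP; apply: measurable_funM => //; apply: measurable_funS mp.
  move=> r /=; rewrite in_itv /= andbT => Mr; rewrite -EFinM lee_fin mulrA.
  by rewrite ler_wpM2r ?powR_ge0 // psi_le_small // ve.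
rewrite [leRHS]EFinM; apply: lee_wpmul2l; first by rewrite lee_fin.
apply: le_trans vK; apply: ge0_subset_integral => //; first exact/measurable_EFinP.
by move=> r _; rewrite lee_fin; exact: pth0.
Qed.

(** The weight r^th times (M / r)^gam has exponent th - gam, above -1 by the choice of [eta]. [B]
    and [s] do not depend on [v], so one integrable function dominates a whole sequence. *)
Lemma head_majorant M : 0 < M -> exists B s, [/\ 0 <= B, -1 < s & forall v r,
  log_energy_le p C v -> `|v M| <= 1 -> 0 < r -> r <= M ->
  psi (v r) * r `^ th <= B * r `^ s].
Proof.
move=> M0.
have X0 : 0 <= mu * C `^ (p - 1)^-1 by rewrite mulr_ge0 // powR_ge0.
have [eta eta0 etaX] := exists_subcritical X0 mulC (ltW q0) q2.
pose gam := mu * (1 + eta) `^ q * C `^ (p - 1)^-1.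
exists (expR (mu * ((1 + eta^-1) `^ q * 1 `^ q)) * M `^ gam), (th - gam); split.
- by rewrite mulr_ge0 ?expR_ge0 ?powR_ge0.
- by move: etaX; rewrite mulrAC -/gam; lra.
move=> v r vC vM r0 rM.
have := expR_growth p1 C0 mu0 eta0 ler01 vC r0 rM vM; rewrite -/q -/gam => h.
have := le_trans (psi_le_exp (v r)) h.
move=> /(ler_wpM2r (powR_ge0 r th))/le_trans; apply.
rewrite powRM ?invr_ge0 ?(ltW M0) ?(ltW r0) // -[r^-1](powR_inv1 (ltW r0)) -powRrM mulN1r.
rewrite -!mulrA ler_wpM2l ?expR_ge0 // ler_wpM2l ?powR_ge0 //.
rewrite -powRD; last by rewrite (gt_eqF r0) implybT.
by rewrite addrC.
Qed.

Definition exp_functional (v : R -> R) : \bar R :=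
  (\int[lebesgue_measure]_(r in `]0%R, +oo[) (psi (v r) * r `^ th)%:E)%E.

Lemma exp_functional_ge0 v : (0 <= exp_functional v)%E.
Proof. by apply: integral_ge0 => r _; rewrite lee_fin mulr_ge0 ?psi_ge0 ?powR_ge0. Qed.

Lemma exp_functional_split v M : energy_ball v -> 0 < M ->
  exp_functional v = (\int[lebesgue_measure]_(r in `]0%R, M[) (psi (v r) * r `^ th)%:E +
    \int[lebesgue_measure]_(r in `[M, +oo[) (psi (v r) * r `^ th)%:E)%E.
Proof.
move=> vB M0.
have E : `]0, +oo[%classic = `]0, M[%classic `|` `[M, +oo[%classic :> set R.
  by rewrite -itv_bndbnd_setU // bnd_simp.
have mf := measurable_psi (energy_ball_continuous vB).
rewrite /exp_functional E ge0_integral_setU //.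
- by rewrite -E; apply/measurable_EFinP.
- by move=> r _; rewrite lee_fin mulr_ge0 ?psi_ge0 ?powR_ge0.
- apply/disj_set2P/seteqP; split => // t []; rewrite /= !in_itv /= andbT => /andP[_].
  by move=> tM; rewrite leNgt tM.
Qed.

Lemma head_integrable B s M : 0 <= B -> -1 < s -> 0 < M ->
  lebesgue_measure.-integrable (`]0, M[ : set R) (EFin \o (fun r => B * r `^ s)).
Proof.
move=> B0 s1 M0.
have ms : measurable_fun (`]0, M[ : set R) (fun r => r `^ s).
  by apply: measurable_funTS; exact: measurable_powR.
have is0 : lebesgue_measure.-integrable (`]0, M[ : set R) (EFin \o (fun r => r `^ s)).
  apply/integrableP; split; first exact/measurable_EFinP.
  apply: le_lt_trans (ltry (M `^ (s + 1) / (s + 1))).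
  apply: le_trans (integral_powR_le s1 M0).
  rewrite le_eqVlt; apply/orP; left; apply/eqP; apply: eq_integral => r _.
  by rewrite /= ger0_norm // powR_ge0.
have m0 : measurable (`]0, M[%classic : set (measurableTypeR R)) by exact: measurable_itv.
have := integrableZl m0 B is0.
by apply: eq_integrable => // r _ /=; rewrite EFinM.
Qed.

(** Makes the supremum finite, so that it can be approached within 1 / (n + 1). The level 1 of the
    decay serves both the tail and the value at [M]. *)
Lemma exp_functional_bounded : exists T : R, forall v, energy_ball v ->
  (exp_functional v <= T%:E)%E.
Proof.
have [M M1 HM] := uniform_decay p1 C0 K0 th0 ltr01.
have M0 : 0 < M by lra.
have [B [s [B0 s1 Hh]]] := head_majorant M0.
have iB := head_integrable B0 s1 M0.
exists (fine (\int[lebesgue_measure]_(r in `]0%R, M[) (B * r `^ s)%:E)%E +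
  mu ^+ N * expR mu * 1 `^ (q * N%:R - p) * K).
move=> v vB; have [vC vK] := vB; have vM := HM v vC vK.
rewrite (exp_functional_split vB M0) EFinD fineK; last exact: integrable_fin_num iB.
apply: leeD; last exact: tail_le.
apply: ge0_le_integral => //.
- by move=> r _; rewrite lee_fin mulr_ge0 ?psi_ge0 ?powR_ge0.
- apply/measurable_EFinP; apply: measurable_funS (measurable_psi (energy_ball_continuous vB)) => //.
  by move=> r /=; rewrite !in_itv /= andbT => /andP[].
- by apply/measurable_EFinP; apply: measurable_funM => //; apply: measurable_funTS; exact: measurable_powR.
- move=> r /=; rewrite in_itv /= => /andP[r0 rM]; rewrite lee_fin.
  by apply: Hh => //; [exact: vM|exact: ltW].
Qed.

Lemma energy_ball_zero : energy_ball (fun=> 0).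
Proof.
split.
  move=> T x y _ _; rewrite big1 ?(ltW C0) // => i _.
  by rewrite subrr normr0 powR0 ?mul0r // gt_eqF.
rewrite integral0_eq ?lee_fin ?(ltW K0) // => r _.
by rewrite normr0 powR0 ?mul0r // gt_eqF.
Qed.

(** Provides the segments for Tychonoff's theorem: the decay bounds [v] at [M], and the modulus of
    continuity carries the bound down to [r]. *)
Lemma energy_ball_locally_bounded : exists B : R -> R, forall v r,
  energy_ball v -> 0 < r -> `|v r| <= B r.
Proof.
have [M M1 HM] := uniform_decay p1 C0 K0 th0 ltr01.
have M0 : 0 < M by lra.
exists (fun r => 1 + C `^ p^-1 * (ln M - ln r) `^ ((p - 1) / p)) => v r [vC vK] r0.
have [rM|Mr] := leP r M; last first.
  by apply: (le_trans (HM v vC vK r (ltW Mr))); rewrite lerDl mulr_ge0 // powR_ge0.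
have := log_energy_modulus p1 (ltW C0) vC r0 rM.
have := HM v vC vK M (lexx M).
have := ler_distD (v M) (v r) 0; rewrite !subr0 (distrC (v r)); lra.
Qed.

Lemma energy_ball_closed (u : nat -> R -> R) v : (forall n, energy_ball (u n)) ->
  (forall r, 0 < r -> u n r @[n --> \oo] --> v r) -> energy_ball v.
Proof.
move=> uB uv; have vC : log_energy_le p C v.
  by apply: (log_energy_closed p1 _ uv) => n; case: (uB n).
split => //.
have mp (w : R -> R) : (forall x : R, 0 < x -> {for x, continuous w}) ->
    measurable_fun (`]0, +oo[ : set R) (fun r => `|w r| `^ p * r `^ th).
  move=> cw; apply: continuous_measurable_pos => x x0.
  apply: cvgM; last exact: continuous_powR_pos.
  apply: (@cvg_comp _ _ _ w (fun a : R => `|a| `^ p) _ (nbhs (w x))); first exact: cw.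
  exact: (continuous_normr_powR p0).
apply: (@fatou_le _ _ (fun n r => `|u n r| `^ p * r `^ th)) => //.
- by move=> n; apply: mp; exact: energy_ball_continuous.
- by apply: mp => x x0; exact: (log_energy_continuous p1 (ltW C0) vC x0).
- by move=> n r _; rewrite mulr_ge0 // powR_ge0.
- by move=> r _; rewrite mulr_ge0 // powR_ge0.
- move=> r e /=; rewrite in_itv /= andbT => r0 e0.
  have : (`|u n r| `^ p * r `^ th) @[n --> \oo] --> `|v r| `^ p * r `^ th.
    apply: cvgM; last exact: cvg_cst.
    apply: (@cvg_comp _ _ _ (u ^~ r) (fun a : R => `|a| `^ p) _ (nbhs (v r))); first exact: uv.
    exact: (continuous_normr_powR p0).
  move=> /cvgrPdist_le/(_ e e0); apply: filterS => n.
  by rewrite ler_norml => /andP[_]; lra.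
- by move=> n; case: (uB n).
Qed.

Lemma head_cvg (u : nat -> R -> R) v M : 0 < M -> (forall n, energy_ball (u n)) ->
  (forall n, `|u n M| <= 1) -> energy_ball v ->
  (forall r, 0 < r -> u n r @[n --> \oo] --> v r) ->
  (\int[lebesgue_measure]_(r in `]0%R, M[) (psi (u n r) * r `^ th)%:E)%E @[n --> \oo] -->
  (\int[lebesgue_measure]_(r in `]0%R, M[) (psi (v r) * r `^ th)%:E)%E.
Proof.
move=> M0 uB uM vB uv; have [B [s [B0 s1 Hh]]] := head_majorant M0.
have m0 : measurable (`]0, M[%classic : set (measurableTypeR R)) by exact: measurable_itv.
apply: (@dominated_cvg _ _ R lebesgue_measure _ m0 (fun n r => (psi (u n r) * r `^ th)%:E)
  (fun r => (psi (v r) * r `^ th)%:E) (EFin \o (fun r => B * r `^ s))) => //.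
- move=> n; apply/measurable_EFinP.
  apply: measurable_funS (measurable_psi (energy_ball_continuous (uB n))) => //.
  by move=> r /=; rewrite !in_itv /= andbT => /andP[].
- move=> r /=; rewrite in_itv /= => /andP[r0 _]; apply: cvg_EFin.
    by apply: nearW.
  apply: cvgM; last exact: cvg_cst.
  apply: (@cvg_comp _ _ _ (u ^~ r) psi _ (nbhs (v r))); first exact: uv.
  exact: psi_continuous.
- exact: head_integrable.
- move=> n r /=; rewrite in_itv /= => /andP[r0 rM]; rewrite lee_fin.
  rewrite ger0_norm ?mulr_ge0 ?psi_ge0 ?powR_ge0 //.
  by apply: Hh => //; [case: (uB n)|exact: ltW].
Qed.

(* Along a maximizing sequence the tails over [M, +oo[ are small by the uniform
   decay, and on ]0, M[ the integrands have an integrable majorant. *)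
Lemma exp_functional_sup_attained : exists2 v, energy_ball v &
  forall u, energy_ball u -> (exp_functional u <= exp_functional v)%E.
Proof.
have [T HT] := exp_functional_bounded.
pose J := ereal_sup [set exp_functional u | u in energy_ball].
have J0 : (0 <= J)%E.
  apply: le_trans (exp_functional_ge0 (fun=> 0)) _; apply: ereal_sup_ubound.
  by exists (fun=> 0) => //; exact: energy_ball_zero.
have JT : (J <= T%:E)%E by apply: ge_ereal_sup => _ [u uB <-]; exact: HT.
have Jfin : J \is a fin_num by rewrite ge0_fin_numE // (le_lt_trans JT) // ltry.
have ch n : exists u, energy_ball u /\ (J - (n.+1%:R^-1)%:E < exp_functional u)%E.
  have [_ [u uB <-] uJ] := ub_ereal_sup_adherent (invn_gt0 R n) Jfin.
  by exists u.
have [u uP] := choice ch.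
have uB n : energy_ball (u n) by case: (uP n).
have [Bd HB] := energy_ball_locally_bounded.
have uBd n r : 0 < r -> `|u n r| <= Bd r by move=> r0; exact: HB.
have uC n : log_energy_le p C (u n) by case: (uB n).
have [v [k [kn kv]]] := pointwise_extraction p1 C0 uC uBd.
have vB : energy_ball v by exact: (energy_ball_closed (fun n => uB (k n)) kv).
exists v; first exact: vB.
move=> z zB; apply: (@le_trans _ _ J); first by apply: ereal_sup_ubound; exists z.
pose A := mu ^+ N * expR mu.
have A0 : 0 <= A by rewrite mulr_ge0 ?exprn_ge0 ?expR_ge0.
(* The last term bounds the tails of all approximants at once. Only the heads pass to the limit, and
   the tail of [v] is dropped as nonnegative. *)
have claim e : 0 < e -> e <= 1 ->
    (J <= exp_functional v + (A * e `^ (q * N%:R - p) * K)%:E)%E.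
  move=> e0 e1; have [M M1 HM] := uniform_decay p1 C0 K0 th0 e0.
  have M0 : 0 < M by lra.
  have HM' w : energy_ball w -> forall r, M <= r -> `|w r| <= e by case=> wC wK; exact: HM.
  have uM n : `|u (k n) M| <= 1 by apply: (le_trans (HM' _ (uB _) _ (lexx M))).
  have Hc := head_cvg M0 (fun n => uB (k n)) uM vB kv.
  set H := (\int[lebesgue_measure]_(r in `]0%R, M[) (psi (v r) * r `^ th)%:E)%E in Hc.
  have Hv : (H <= exp_functional v)%E.
    by rewrite (exp_functional_split vB M0) leeDl // integral_ge0 // => r _;
       rewrite lee_fin mulr_ge0 ?psi_ge0 ?powR_ge0.
  apply: (@le_trans _ _ (H + (A * e `^ (q * N%:R - p) * K)%:E)%E); last by rewrite leeD2r.
  have c2 : ((A * e `^ (q * N%:R - p) * K + n.+1%:R^-1)%:E) @[n --> \oo] -->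
      (A * e `^ (q * N%:R - p) * K)%:E.
    apply: cvg_EFin; first exact: nearW.
    rewrite -[X in _ --> X]addr0; apply: cvgD; [exact: cvg_cst|exact: cvg_harmonic].
  have c3 : (\int[lebesgue_measure]_(r in `]0%R, M[) (psi (u (k n) r) * r `^ th)%:E +
      (A * e `^ (q * N%:R - p) * K + n.+1%:R^-1)%:E)%E @[n --> \oo] -->
      (H + (A * e `^ (q * N%:R - p) * K)%:E)%E.
    by apply: cvgeD => //; exact: fin_num_adde_defl.
  rewrite -(cvg_lim _ c3) //; apply: lime_ge; first by apply/cvg_ex; eexists; exact: c3.
  apply: nearW => n; have [_ /ltW] := uP (k n).
  rewrite leeBlDr // => /le_trans; apply.
  rewrite (exp_functional_split (uB (k n)) M0) -addeA leeD2l // EFinD leeD //.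
    exact: (tail_le (uB (k n)) M0 e1 (HM' _ (uB (k n)))).
  by rewrite lee_fin lef_pV2 ?posrE ?ltr0n // ler_nat ltnS.
apply/lee_addgt0Pr => eta eta0.
have kap0 : 0 < q * N%:R - p.
  by rewrite subr_gt0 /q mulrAC ltr_pdivlMr // ltr_pM2l.
have AK : 0 < A * K + 1 by rewrite ltr_wpDl // mulr_ge0 // ltW.
(* Chosen so that A K e^(q N - p) <= eta; the 1 added to A K matters when mu = 0, where [A]
   vanishes. *)
pose e := Num.min 1 ((eta / (A * K + 1)) `^ (q * N%:R - p)^-1).
have e0 : 0 < e by rewrite lt_min ltr01 powR_gt0 // divr_gt0.
have e1 : e <= 1 by rewrite ge_min lexx.
apply: (le_trans (claim e e0 e1)); rewrite leeD2l // lee_fin.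
have : e `^ (q * N%:R - p) <= eta / (A * K + 1).
  have h : e <= (eta / (A * K + 1)) `^ (q * N%:R - p)^-1 by rewrite ge_min lexx orbT.
  apply: (le_trans (ge0_ler_powR (ltW kap0) _ _ h)); rewrite ?nnegrE ?powR_ge0 ?(ltW e0) //.
  by rewrite -powRrM mulVf ?gt_eqF // powRr1 // divr_ge0 // ltW.
rewrite ler_pdivlMr // => h; have ek0 := powR_ge0 e (q * N%:R - p).
apply: le_trans h; rewrite mulrAC mulrC ler_wpM2l //.
by rewrite lerDl.
Qed.

End exponential_functional.

(** * The quotient *)

(** As a function of ln r, min r 1 has slope r <= 1 below 1 and slope 0 above. *)
Lemma min1B_le_lnB (R : realType) (x y : R) : 0 < x -> x <= y ->
  Num.min y 1 - Num.min x 1 <= ln y - ln x.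
Proof.
move=> x0 xy; have y0 : 0 < y by exact: lt_le_trans xy.
have lxy : ln x <= ln y by rewrite ler_ln.
have [x1|x1] := leP 1 x.
  by rewrite [Num.min y 1]min_r ?(le_trans x1) // subrr subr_ge0.
set y' := Num.min y 1.
have y'0 : 0 < y' by rewrite lt_min y0 ltr01.
have y'1 : y' <= 1 by rewrite ge_min lexx orbT.
have y'y : y' <= y by rewrite ge_min lexx.
have xy' : x <= y' by rewrite le_min xy ltW.
have : ln y' <= ln y by rewrite ler_ln.
have : ln (x / y') <= x / y' - 1.
  rewrite -{1}(subrK 1 (x / y')) addrC le_ln1Dx // ltrBrDl.
  by rewrite (_ : 1 + -1 = 0) ?subrr // divr_gt0.
rewrite ln_div ?posrE //.
have : (1 - x / y') * y' = y' - x by rewrite mulrBl mul1r divfK // gt_eqF.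
have : x / y' <= 1 by rewrite ler_pdivrMr // mul1r.
by nra.
Qed.

(** The truncated intervals are disjoint subsets of ]0, 1[, those beyond 1 becoming empty; their
    lengths are integrals of the indicator of ]0, 1[. *)
Lemma sum_min1B_le1 (R : realType) (T : finType) (x y : T -> R) :
  (forall i, 0 < x i <= y i) -> trivIset setT (fun i => `]x i, y i[%classic) ->
  \sum_i (Num.min (y i) 1 - Num.min (x i) 1) <= 1.
Proof.
move=> xy /trivIset_oo tI.
pose x' i := Num.min (x i) 1; pose y' i := Num.min (y i) 1.
have x'0 i : 0 < x' i by have /andP[? _] := xy i; rewrite lt_min ltr01 andbT.
have xy' i : x' i <= y' i by have /andP[_ ?] := xy i; rewrite le_min2.
have tI' : trivIset setT (fun i => `]x' i, y' i[%classic).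
  apply/trivIset_oo => i j z; rewrite /x' /y' => /andP[zi iz] /andP[zj jz].
  move: iz jz; rewrite !lt_min => /andP[iz z1] /andP[jz _].
  apply: (tI i j z); rewrite ?iz ?jz andbT.
    by move: zi; rewrite gt_min => /orP[//|/lt_trans/(_ z1)]; rewrite ltxx.
  by move: zj; rewrite gt_min => /orP[//|/lt_trans/(_ z1)]; rewrite ltxx.
have m (i : interval R) : measurable ([set` i] : set R) by exact: measurable_itv.
pose g := \1_(`]0, 1[%classic : set R) : R -> R.
have mg : measurable_fun (`]0, +oo[ : set R) g.
  by apply: measurable_funTS; apply: measurable_indic; exact: m.
have g0 (r : R) : 0 < r -> 0 <= g r by move=> _; rewrite /g indicE ler0n.
have := sum_integral_oo_le g0 mg x'0 tI'.
have -> : (\int[lebesgue_measure]_(r in `]0%R, +oo[) (g r)%:E)%E = 1%:E.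
  have mE : lebesgue_measure (`]0%R, 1%R[%classic : set R) = 1%:E.
    by rewrite lebesgue_measure_itv /= lte_fin ltr01 sube0.
  rewrite integral_indic // setIidl; first exact: mE.
  by move=> r /=; rewrite !in_itv /= andbT => /andP[].
have -> : (\sum_i \int[lebesgue_measure]_(r in `]x' i, y' i[) (g r)%:E)%E =
   (\sum_i (y' i - x' i))%:E.
  rewrite -sumEFin; apply: eq_bigr => i _.
  have -> : (\int[lebesgue_measure]_(r in `]x' i, y' i[) (g r)%:E)%E =
     (\int[lebesgue_measure]_(r in `]x' i, y' i[) 1%:E)%E.
    apply: eq_integral => r; rewrite inE /= in_itv /= => /andP[xr ry].
    rewrite /g indicE mem_set //= in_itv /= (lt_trans (x'0 i) xr) /=.
    by apply: lt_le_trans ry _; rewrite ge_min lexx orbT.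
  have mE : lebesgue_measure (`]x' i, y' i[%classic : set R) = (y' i - x' i)%:E.
    rewrite lebesgue_measure_itv /= lte_fin.
    by case: ltgtP (xy' i) => // -> _; rewrite subrr.
  by rewrite integral_cst // mul1e; exact: mE.
by rewrite lee_fin.
Qed.

(** A nonzero function of finite norm, the witness in case the maximizer over the ball vanishes. *)
Definition tent (R : realType) (c r : R) : R := c * (1 - Num.min r 1).

(** An increment d of min r 1 is at most that of ln, so d^p over the latter to the power p - 1 is at
    most d, and these d add up to at most 1. The height C^(1 / p) contributes the factor C. *)
Lemma log_energy_tent (R : realType) (p C : R) : 1 < p -> 0 < C ->
  log_energy_le p C (tent (C `^ p^-1)).
Proof.
move=> p1 C0 T x y xy tI; have p0 : 0 < p by lra.
have := ler_wpM2l (ltW C0) (sum_min1B_le1 xy tI); rewrite mulr1.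
apply: le_trans; rewrite mulr_sumr; apply: ler_sum => i _.
have /andP[x0 xyi] := xy i.
set d := Num.min (y i) 1 - Num.min (x i) 1.
have d0 : 0 <= d by rewrite subr_ge0 le_min2.
have dl : d <= ln (y i) - ln (x i) by exact: min1B_le_lnB.
have -> : `|tent (C `^ p^-1) (y i) - tent (C `^ p^-1) (x i)| = C `^ p^-1 * d.
  rewrite /tent -mulrBr (_ : _ - _ - _ = - d); last by rewrite /d; ring.
  by rewrite normrM normrN !ger0_norm // powR_ge0.
rewrite powRM ?powR_ge0 // -powRrM mulVf ?gt_eqF // powRr1 ?(ltW C0) // -mulrA.
rewrite ler_wpM2l ?(ltW C0) //.
have [->|dn0] := eqVneq d 0; first by rewrite powR0 ?gt_eqF // mul0r.
have l0 : 0 < ln (y i) - ln (x i) by apply: lt_le_trans dl; rewrite lt_neqAle eq_sym dn0.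
rewrite ler_pdivrMr ?powR_gt0 // -(mulr_powRB1 d0 p0) ler_wpM2l //.
by rewrite ge0_ler_powR ?nnegrE ?(ltW l0) //; lra.
Qed.

Definition weighted_power (R : realType) (p th : R) (v : R -> R) : \bar R :=
  (\int[lebesgue_measure]_(r in `]0%R, +oo[) (`|v r| `^ p * r `^ th)%:E)%E.

Lemma weighted_power_tent (R : realType) (p th c : R) : 0 < p -> 0 <= th -> 0 <= c ->
  (weighted_power p th (tent c) < +oo)%E.
Proof.
move=> p0 th0 c0.
have m (i : interval R) : measurable ([set` i] : set R) by exact: measurable_itv.
have mt : measurable_fun (setT : set R) (tent c).
  apply: measurable_funM => //; apply: measurable_funB => //.
  exact: measurable_minr.
have mI : measurable_fun (`]0, +oo[ : set R) (\1_(`]0, 1]%classic : set R) : R -> R).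
  by apply: measurable_funTS; apply: measurable_indic; exact: m.
have cp0 : 0 <= c `^ p by exact: powR_ge0.
apply: (@le_lt_trans _ _ (\int[lebesgue_measure]_(r in `]0%R, +oo[)
    ((c `^ p)%:E * (\1_(`]0%R, 1%R]%classic : set R) r)%:E))%E).
  apply: ge0_le_integral => //.
  - by move=> r _; rewrite lee_fin mulr_ge0 // powR_ge0.
  - apply/measurable_EFinP; apply: measurable_funTS; apply: measurable_funM => //.
    + by apply: (measurableT_comp (measurable_powR _)); apply: (measurableT_comp _ mt).
  - by apply/measurable_EFinP; apply: measurable_funM.
  - move=> r /=; rewrite in_itv /= andbT => r0; rewrite -EFinM lee_fin indicE.
    have [r1|r1] := leP r 1.
      rewrite mem_set /= ?in_itv /= ?r0 ?r1 // mulr1.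
      rewrite -[leRHS]mulr1 ler_pM ?powR_ge0 //.
        rewrite ge0_ler_powR ?nnegrE ?(ltW p0) // /tent min_l // ger0_norm ?mulr_ge0 ?subr_ge0 //.
        by rewrite ler_piMr // gerBl ltW.
      by have := @ge0_ler_powR R th th0 r 1; rewrite !nnegrE powR1; apply; lra.
    rewrite /tent min_r ?(ltW r1) // subrr mulr0 normr0 powR0 ?gt_eqF // mul0r.
    by rewrite mulr_ge0.
rewrite ge0_integralZl_EFin //; first last.
- exact/measurable_EFinP.
have mE : lebesgue_measure (`]0%R, 1%R]%classic : set R) = 1%:E.
  by rewrite lebesgue_measure_itv /= lte_fin ltr01 sube0.
rewrite integral_indic // setIidl; last first.
  by move=> r /=; rewrite !in_itv /= andbT => /andP[].
apply: (@le_lt_trans _ _ ((c `^ p)%:E * 1%:E)%E); last by rewrite -EFinM ltry.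
by apply: lee_wpmul2l; [rewrite lee_fin|rewrite -mE].
Qed.

Lemma weighted_power_gt0 (R : realType) (p th : R) (v : R -> R) :
  0 < p -> (forall x : R, 0 < x -> {for x, continuous v}) -> nonzero v ->
  (0 < weighted_power p th v)%E.
Proof.
move=> p0 cv [r0 r00 vr0].
pose g r := `|v r| `^ p * r `^ th.
have cg (x : R) : 0 < x -> {for x, continuous g}.
  move=> x0; apply: cvgM; last exact: continuous_powR_pos.
  apply: (@cvg_comp _ _ _ v (fun a : R => `|a| `^ p) _ (nbhs (v x))); first exact: cv.
  exact: (continuous_normr_powR p0).
have g0 r : 0 < r -> 0 <= g r by move=> _; rewrite mulr_ge0 // powR_ge0.
have gr0 : 0 < g r0 by rewrite mulr_gt0 ?powR_gt0 // normr_gt0.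
have : \forall r \near r0, g r0 / 2 < g r.
  have := cg _ r00 => /cvgrPdist_lt/(_ (g r0 / 2)); rewrite divr_gt0 // => /(_ isT).
  by apply: filterS => r; rewrite ltr_norml => /andP[_]; lra.
move=> /nbhs_ballP[d /= d0 Hd].
have bd : r0 < r0 + d by lra.
rewrite lt_neqAle integral_ge0 ?andbT; last by move=> r /= ; rewrite lee_fin in_itv /= andbT => /g0.
apply/eqP => I0.
(* If the integral were 0, this bound would give a point with g s <= g r0 / 4, whereas g > g r0 / 2
   on the whole interval. *)
have K0 : 0 < g r0 * d / 8 by rewrite divr_gt0 // mulr_gt0.
have [|s [s1 s2]] := integral_pigeonhole r00 bd K0 (continuous_measurable_pos cg) g0.
  by move: I0; rewrite /weighted_power => <-; rewrite lee_fin ltW.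
have : g r0 / 2 < g s.
  by apply: Hd; rewrite /ball /= ltr0_norm; lra.
rewrite (_ : r0 + d - r0 = d); last by ring.
by move: gr0 d0; nra.
Qed.

(** Only differences of logarithms enter, and a dilation leaves them unchanged. *)
Lemma log_energy_scale (R : realType) (p C l : R) (v : R -> R) : 0 < l ->
  log_energy_le p C v -> log_energy_le p C (fun r => v (l * r)).
Proof.
move=> l0 vC T x y xy /trivIset_oo tI.
have lnl i : ln (y i) - ln (x i) = ln (l * y i) - ln (l * x i).
  have /andP[xi yi] := xy i; have y0 : 0 < y i by exact: lt_le_trans yi.
  by rewrite !lnM ?posrE //; ring.
under eq_bigr do rewrite lnl.
apply: (vC T (fun i => l * x i) (fun i => l * y i)).
  by move=> i; have /andP[xi yi] := xy i; rewrite mulr_gt0 //= ler_pM2l.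
apply/trivIset_oo => i j z /andP[zi iz] /andP[zj jz].
by apply: (tI i j (l^-1 * z)); rewrite ltr_pdivlMl // ltr_pdivrMl ?zi ?zj.
Qed.

Lemma weighted_integral_scale (R : realType) (f : R -> R) (th l : R) : 0 < l ->
  (forall x : R, 0 < x -> {for x, continuous f}) -> (forall x, 0 <= f x) ->
  (\int[lebesgue_measure]_(x in `]0%R, +oo[) (f (l * x) * x `^ th)%:E =
   (l `^ (- (th + 1)))%:E * \int[lebesgue_measure]_(x in `]0%R, +oo[) (f x * x `^ th)%:E)%E.
Proof.
move=> l0 cf f0; pose h x := f x * x `^ th.
have ch (x : R) : 0 < x -> {for x, continuous h}.
  by move=> x0; apply: cvgM; [exact: cf|exact: continuous_powR_pos].
have h0 x : 0 < x -> 0 <= h x by move=> _; rewrite mulr_ge0 // powR_ge0.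
have chl (x : R) : 0 < x -> {for x, continuous (fun y => h (l * y))}.
  move=> x0; apply: (@cvg_comp _ _ _ (fun y => l * y) h _ (nbhs (l * x))).
    by apply: cvgM; [exact: cvg_cst|exact: cvg_id].
  by apply: ch; rewrite mulr_gt0.
have -> : (\int[lebesgue_measure]_(x in `]0%R, +oo[) (f (l * x) * x `^ th)%:E =
   \int[lebesgue_measure]_(x in `]0%R, +oo[) ((l `^ (- th))%:E * (h (l * x))%:E))%E.
  apply: eq_integral => x; rewrite inE /= in_itv /= andbT => x0.
  rewrite -EFinM; congr (_%:E); rewrite /h powRM ?(ltW l0) ?(ltW x0) // powRN.
  by field; rewrite gt_eqF // powR_gt0.
have m0 : measurable (`]0%R, +oo[%classic : set R) by exact: measurable_itv.
rewrite ge0_integralZl_EFin; first last.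
- exact: powR_ge0.
- by apply/measurable_EFinP; exact: continuous_measurable_pos.
- by move=> x /=; rewrite in_itv /= andbT => x0; rewrite lee_fin h0 // mulr_gt0.
- exact: m0.
rewrite integral_scale // muleA -EFinM; congr (_%:E * _)%E.
rewrite opprD powRD; last by rewrite (gt_eqF l0) implybT.
by rewrite powR_inv1 // ltW.
Qed.

(** * Reduction of the quotient to the integral of psi *)

Lemma wnorm_powR (R : realType) (p th : R) (u : R -> R) : 0 <= omega th -> p != 0 ->
  (wnorm p th u `^ p = (omega th)%:E * weighted_power p th u)%E.
Proof.
move=> w0 p0; rewrite /wnorm -poweRrM mulVf // poweRe1 //.
by rewrite mule_ge0 ?lee_fin // integral_ge0 // => r _; rewrite lee_fin mulr_ge0 // powR_ge0.
Qed.

(** At mu |u|^(p / (p - 1)) the power p - 1 is mu^(p - 1) |u|^p, which integrates to a multiple of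
    [P]; the factor [omega th] of norm and integral cancels. *)
Lemma TM_quotientE (R : realType) (p th mu P : R) (u : R -> R) :
  2 <= p -> 0 <= th -> 0 <= mu -> (forall x : R, 0 < x -> {for x, continuous u}) ->
  0 < P -> weighted_power p th u = P%:E ->
  (TM_quotient p th mu u =
   ((\sum_(0 <= j < (Num.trunc (p - 1)).+1 | p - 1 <= j%:R) j`!%:R^-1) * mu `^ (p - 1))%:E +
   (P^-1)%:E * exp_functional p th mu (Num.trunc (p - 1)).+1 u)%E.
Proof.
move=> p2 th0 mu0 cu P0 uP; have p0 : 0 < p by lra.
have p10 : 0 < p - 1 by lra.
have w0 : 0 < omega th by exact: omega_gt0.
have wP0 : 0 < omega th * P by exact: mulr_gt0.
set N := (Num.trunc (p - 1)).+1.
set c := \sum_(0 <= j < N | _) _.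
have c0 : 0 <= c by apply: sumr_ge0 => j _; rewrite invr_ge0 ler0n.
rewrite /TM_quotient wnorm_powR ?(ltW w0) ?gt_eqF // uP -EFinM inver (gt_eqF wP0).
have -> : wint th (fun r => phi p (mu * `|u r| `^ (p / (p - 1)))) =
  ((omega th)%:E * ((c * mu `^ (p - 1) * P)%:E + exp_functional p th mu N u))%E.
  rewrite /wint; congr (_ * _)%E.
  have m0 : measurable (`]0%R, +oo[%classic : set R) by exact: measurable_itv.
  have mp : measurable_fun (`]0, +oo[ : set R) (fun r => `|u r| `^ p * r `^ th).
    apply: continuous_measurable_pos => x x0.
    apply: cvgM; last exact: continuous_powR_pos.
    apply: (@cvg_comp _ _ _ u (fun a : R => `|a| `^ p) _ (nbhs (u x))); first exact: cu.
    exact: (continuous_normr_powR p0).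
  rewrite EFinM -uP /weighted_power -ge0_integralZl_EFin //; first last.
  - by rewrite mulr_ge0 // powR_ge0.
  - exact/measurable_EFinP.
  - by move=> r _; rewrite lee_fin mulr_ge0 // powR_ge0.
  rewrite /exp_functional -ge0_integralD //; first last.
  - by apply/measurable_EFinP; exact: measurable_psi.
  - by move=> r _; rewrite lee_fin mulr_ge0 ?powR_ge0 // psi_ge0.
  - by apply/measurable_EFinP; apply: measurable_funM.
  - by move=> r _; rewrite -EFinM lee_fin !mulr_ge0 // powR_ge0.
  apply: eq_integral => r _; rewrite -EFinM -EFinD; congr (_%:E).
  have muq0 : 0 <= mu * `|u r| `^ (p / (p - 1)) by rewrite mulr_ge0 // powR_ge0.
  rewrite phi_split //; last by lra.
  rewrite powRM ?powR_ge0 // -powRrM divfK ?gt_eqF // -/N -/c.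
  by ring.
have E0 : (0 <= exp_functional p th mu N u)%E by exact: exp_functional_ge0.
rewrite muleA -EFinM ge0_muleDr ?lee_fin ?mulr_ge0 ?powR_ge0 ?(ltW P0) //.
rewrite (_ : (omega th * P)^-1 * omega th = P^-1); last by field; rewrite !gt_eqF.
congr (_ + _)%E; rewrite -EFinM; congr (_%:E).
by field; rewrite gt_eqF.
Qed.

Lemma Xspace_of_log_energy (R : realType) (p th C : R) (v : R -> R) :
  1 < p -> 0 <= th -> C = (omega (p - 1))^-1 -> 0 < C -> log_energy_le p C v ->
  (weighted_power p th v < +oo)%E ->
  Xspace p (p - 1) th v /\ (wnorm p (p - 1) (derive1 v) <= 1)%E.
Proof.
move=> p1 th0 CE C0 vC vfin; have p0 : 0 < p by lra.
have p10 : 0 <= p - 1 by lra.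
have wa0 : 0 < omega (p - 1) by exact: omega_gt0.
have wt0 : 0 < omega th by exact: omega_gt0.
have cv (x : R) : 0 < x -> {for x, continuous v}.
  by move=> x0; exact: (log_energy_continuous p1 (ltW C0) vC x0).
have P0 : (0 <= weighted_power p th v)%E.
  by apply: integral_ge0 => r _; rewrite lee_fin mulr_ge0 // powR_ge0.
have norm1 : (wnorm p (p - 1) (derive1 v) <= 1)%E.
  rewrite /wnorm.
  have : (wint (p - 1) (fun r => `|derive1 v r| `^ p)%R <= 1%:E)%E.
    rewrite /wint.
    have -> : 1%:E = ((omega (p - 1))%:E * C%:E)%E :> \bar R.
      by rewrite -EFinM CE mulfV // gt_eqF.
    apply: lee_wpmul2l; first by rewrite lee_fin ltW.
    exact: (log_energy_derive1_le p1 (ltW C0) vC).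
  have w0 : (0 <= wint (p - 1) (fun r => `|derive1 v r| `^ p)%R)%E.
    by rewrite mule_ge0 ?lee_fin ?(ltW wa0) // integral_ge0 // => r _;
      rewrite lee_fin mulr_ge0 // powR_ge0.
  move=> w1; rewrite -[leRHS](poweR1r p^-1).
  apply: gt0_ler_poweR => //; rewrite ?invr_ge0 ?(ltW p0) //.
  - by rewrite in_itv /= w0 leey.
  - by rewrite in_itv /= leey andbT lee_fin.
split => //; split.
- exact: (log_energy_loc_abs_continuous p1 (ltW C0) vC).
- apply/cvgrPdist_le => e e0.
  (* The decay estimate asks for a positive bound on the integral, hence the 1. *)
  have K0 : 0 < fine (weighted_power p th v) + 1.
    by rewrite ltr_wpDl // fine_ge0.
  have [M M1 HM] := uniform_decay p1 C0 K0 th0 e0.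
  have vK : (weighted_power p th v <= (fine (weighted_power p th v) + 1)%:E)%E.
    have vf : weighted_power p th v \is a fin_num by rewrite ge0_fin_numE.
    by rewrite -[leLHS](fineK vf) lee_fin lerDl.
  near=> r; rewrite sub0r normrN; apply: (HM v vC vK).
  by near: r; apply: nbhs_pinfty_ge; exact: num_real.
- split; first exact: continuous_measurable_pos.
  apply: poweR_lty; rewrite /wint.
  by apply: lte_mul_pinfty; rewrite ?lee_fin ?(ltW wt0).
- split; first exact: measurable_derive1_pos.
  by apply: le_lt_trans norm1 _; rewrite ltry.
Unshelve. all: by end_near. Qed.

(* Dilating u by l = (P / K)^(1 / (th + 1)) preserves its log-energy and puts it
   on the boundary of the energy ball. *)
Lemma exp_functional_scaled_le (R : realType) (p C K th mu P : R) (N : nat) (J : \bar R)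
    (u : R -> R) :
  2 <= p -> 0 < C -> 0 < K -> 0 <= th -> 0 <= mu -> 0 < P ->
  (forall w, energy_ball p C K th w -> (exp_functional p th mu N w <= J)%E) ->
  log_energy_le p C u -> weighted_power p th u = P%:E ->
  ((P^-1)%:E * exp_functional p th mu N u <= (K^-1)%:E * J)%E.
Proof.
move=> p2 C0 K0 th0 mu0 P0 HJ uC uP.
have p1 : 1 < p by lra.
have p0 : 0 < p by lra.
have th10 : 0 < th + 1 by lra.
have cu (x : R) : 0 < x -> {for x, continuous u}.
  by move=> x0; exact: (log_energy_continuous p1 (ltW C0) uC x0).
pose l := (P / K) `^ (th + 1)^-1.
have PK0 : 0 < P / K by rewrite divr_gt0.
have l0 : 0 < l by exact: powR_gt0.
have lE : l `^ (- (th + 1)) = K / P.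
  by rewrite /l -powRrM mulrN mulVf ?gt_eqF // powR_inv1 ?(ltW PK0) // invf_div.
have cont (f : R -> R) : continuous f -> forall x : R, 0 < x -> {for x, continuous (f \o u)}.
  move=> cf x x0; apply: (@cvg_comp _ _ _ u f _ (nbhs (u x))); first exact: cu.
  exact: cf.
have wB : energy_ball p C K th (fun r => u (l * r)).
  split; first exact: log_energy_scale.
  rewrite (@weighted_integral_scale R (fun r => `|u r| `^ p) th l l0) //.
  - by rewrite -/(weighted_power p th u) uP lE -EFinM lee_fin divfK // gt_eqF.
  - exact: (cont _ (continuous_normr_powR p0)).
have := HJ _ wB; rewrite /exp_functional.
rewrite (@weighted_integral_scale R (fun r => exp_tail N (mu * `|u r| `^ (p / (p - 1)))) th l l0).
- rewrite -/(exp_functional p th mu N u) lE => H.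
  have := lee_wpmul2l (_ : (0 <= (K^-1)%:E)%E) H.
  rewrite lee_fin invr_ge0 (ltW K0) muleA -EFinM mulrA mulVf ?gt_eqF // mul1r.
  exact.
- exact: (cont (fun a => exp_tail N (mu * `|a| `^ (p / (p - 1)))) (@psi_continuous R p mu N p2)).
- by move=> x; exact: psi_ge0.
Qed.

Lemma exp_tail_at0 (R : realType) (N : nat) : exp_tail N.+1 (0 : R) = 0.
Proof.
apply/le_anti; rewrite exp_tail_ge0 // andbT.
by rewrite (le_trans (exp_tail_le _ _)) // expr0n /= mul0r.
Qed.

Lemma nonzero_tent (R : realType) (c : R) : 0 < c -> nonzero (tent c).
Proof.
move=> c0; exists 2^-1; first by rewrite invr_gt0.
rewrite /tent min_l; last by lra.
by rewrite mulf_neq0 ?gt_eqF //; lra.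
Qed.

Theorem theorem1p3 (R : realType) (p alpha theta mu : R)
    (hp : 2 <= p) (halpha : alpha = p - 1) (htheta : 0 <= theta)
    (hmu0 : 0 <= mu) (hmu : mu < mu_crit alpha theta) :
  exists u : R -> R,
    [/\ Xspace p alpha theta u,
        nonzero u,
        (wnorm p alpha (derive1 u) <= 1)%E &
        TMSC p mu alpha theta = TM_quotient p theta mu u].
Proof.
have p1 : 1 < p by lra.
have p0 : 0 < p by lra.
have p10 : 0 < p - 1 by lra.
(* The constraints that the norms of u' and u be at most 1, with the factors omega moved to the
   right-hand side. *)
subst alpha; set C := (omega (p - 1))^-1; set K := (omega theta)^-1.
have wa0 : 0 < omega (p - 1) by apply: omega_gt0; exact: ltW.
have C0 : 0 < C by rewrite invr_gt0.
have K0 : 0 < K by rewrite invr_gt0 omega_gt0.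
set N := (Num.trunc (p - 1)).+1.
have pN : p - 1 < N%:R by have /andP[] := truncn_itv (ltW p10).
(* This is [hmu] divided by omega_alpha^(1 / alpha), the form in which it bounds the exponent of the
   majorant near 0. *)
have muC : mu * C `^ (p - 1)^-1 < theta + 1.
  have -> : C `^ (p - 1)^-1 = (omega (p - 1) `^ (p - 1)^-1)^-1.
    by rewrite /C -powR_inv1 ?(ltW wa0) // -powRrM mulN1r powRN.
  by rewrite ltr_pdivrMr ?powR_gt0.
have [v vB vmax] := exp_functional_sup_attained hp C0 K0 htheta hmu0 muC pN.
set J := exp_functional p theta mu N v in vmax.
set c := (\sum_(0 <= j < N | p - 1 <= j%:R) j`!%:R^-1) * mu `^ (p - 1).
have adm_le u : admissible p (p - 1) theta u -> (TM_quotient p theta mu u <= c%:E + (K^-1)%:E * J)%E.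
  move=> [[ulac _ [_ ufin] [mdu _]] u0 du1].
  have w0 : 0 < omega theta by exact: omega_gt0.
  have uC : log_energy_le p C u.
    apply: log_energy_of_derive1 => //.
    rewrite -/(weighted_power p (p - 1) (derive1 u)).
    have W1 : ((omega (p - 1))%:E * weighted_power p (p - 1) (derive1 u) <= 1%:E)%E.
      rewrite -wnorm_powR ?gt_eqF ?(ltW wa0) // -[leRHS](poweR1r p).
      by apply: gt0_ler_poweR; rewrite ?(ltW p0) // in_itv /= leey andbT ?poweR_ge0 // lee_fin.
    have := lee_wpmul2l (_ : (0 <= C%:E)%E) W1.
    rewrite lee_fin (ltW C0) muleA -EFinM mulVf ?gt_eqF // mul1e mule1; exact.
  have cu (x : R) : 0 < x -> {for x, continuous u}.
    by move=> x0; exact: (log_energy_continuous p1 (ltW C0) uC x0).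
  have P0 : (0 < weighted_power p theta u)%E by exact: weighted_power_gt0.
  have Pfin : weighted_power p theta u \is a fin_num.
    rewrite ge0_fin_numE ?(ltW P0) //.
    have := poweR_lty p ufin; rewrite wnorm_powR ?gt_eqF ?(ltW w0) // => wP.
    have := @lte_mul_pinfty R K%:E _ (_ : (0 <= K%:E)%E) isT wP.
    rewrite lee_fin (ltW K0) muleA -EFinM mulVf ?gt_eqF // mul1e; exact.
  have uP := esym (fineK Pfin).
  have fP0 : 0 < fine (weighted_power p theta u).
    by rewrite -lte_fin fineK.
  have -> := TM_quotientE hp htheta hmu0 cu fP0 uP; apply: leeD2l.
  exact: (exp_functional_scaled_le hp C0 K0 htheta hmu0 fP0 vmax uC uP).
(* The upper bound for all quotients is fixed, so a nonzero function of finite norm and energy at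
   most [C] that reaches it is a maximizer. *)
have low z : log_energy_le p C z -> (weighted_power p theta z < +oo)%E -> nonzero z ->
    (c%:E + (K^-1)%:E * J <= TM_quotient p theta mu z)%E ->
  [/\ Xspace p (p - 1) theta z, nonzero z, (wnorm p (p - 1) (derive1 z) <= 1)%E &
      TMSC p mu (p - 1) theta = TM_quotient p theta mu z].
  move=> zC zfin z0 zJ; have [zX z1] := Xspace_of_log_energy p1 htheta (erefl _) C0 zC zfin.
  split => //; apply/le_anti/andP; split.
    apply: ge_ereal_sup => _ [u ua <-]; exact: le_trans (adm_le u ua) zJ.
  by apply: ereal_sup_ubound; exists z.
have [vC vK] := vB.
have J0 : (0 <= J)%E by exact: exp_functional_ge0.
have quot z : log_energy_le p C z -> (weighted_power p theta z < +oo)%E -> nonzero z ->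
    exists2 P, 0 < P & weighted_power p theta z = P%:E /\
    TM_quotient p theta mu z = (c%:E + (P^-1)%:E * exp_functional p theta mu N z)%E.
  move=> zC zfin z0.
  have cz (x : R) : 0 < x -> {for x, continuous z}.
    by move=> x0; exact: (log_energy_continuous p1 (ltW C0) zC x0).
  have P0 : (0 < weighted_power p theta z)%E by exact: weighted_power_gt0.
  have Pfin : weighted_power p theta z \is a fin_num by rewrite ge0_fin_numE // ltW.
  exists (fine (weighted_power p theta z)); first by rewrite -lte_fin fineK.
  split; first by rewrite fineK.
  by apply: TM_quotientE; rewrite ?fineK // -lte_fin fineK.
have [vnz|vz] := pselect (nonzero v).
  have vfin : (weighted_power p theta v < +oo)%E by apply: le_lt_trans vK _; rewrite ltry.
  exists v; apply: low => //.
  have [P P0 [vP ->]] := quot v vC vfin vnz.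
  (* Here P <= K is all that is known of the norm of the limit; as J >= 0, replacing 1 / K by 1 / P
     does not lower the quotient. *)
  apply: leeD2l; apply: lee_wpmul2r; first exact: J0.
  have PK : P <= K by rewrite -lee_fin -vP.
  by rewrite lee_fin lef_pV2 // posrE.
have JE : J = 0%E.
  apply: integral0_eq => r /=; rewrite in_itv /= andbT => r0.
  have -> : v r = 0.
    by apply: contrapT => /eqP vr; apply: vz; exists r.
  by rewrite normr0 powR0 ?gt_eqF ?divr_gt0 // mulr0 exp_tail_at0 mul0r.
have t0 : 0 < C `^ p^-1 by exact: powR_gt0.
exists (tent (C `^ p^-1)).
have tC := log_energy_tent p1 C0.
have tfin := weighted_power_tent p0 htheta (ltW t0).
have tnz := nonzero_tent t0.
apply: low => //; have [P P0 [_ ->]] := quot _ tC tfin tnz.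
rewrite JE mule0; apply: leeD2l; apply: mule_ge0; first by rewrite lee_fin invr_ge0 ltW.
exact: exp_functional_ge0.
Qed.
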